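(* Let $-\infty\le a<b\le\infty$ and let $\varrho,\varsigma,\chi$ be locally finite complex Borel measures on $(a,b)$ with $\operatorname{supp}(\varsigma)=(a,b)$ and $\varsigma(\{x\})\varrho(\{x\})=\varsigma(\{x\})\chi(\{x\})=0$ for all $x\in(a,b)$. Suppose $\tau$ is regular at $a$, i.e. $|\varrho|((a,c])$, $|\varsigma|((a,c])$, $|\chi|((a,c])$ are finite for some (equivalently all) $c\in(a,b)$. Let $z\in\mathbb{C}$ and $g\in L^1_{loc}((a,b);|\varrho|)$ with $g\in L^1((a,c);|\varrho|)$ for each $c\in(a,b)$. Then for every solution $f\in\mathfrak{D}_\tau$ of $(\tau-z)f=g$ the limits $f(a):=\lim_{x\downarrow a}f(x)$ and $f^{[1]}(a):=\lim_{x\downarrow a}f^{[1]}(x)$ exist and are finite. For each $d_1,d_2\in\mathbb{C}$ there is a unique solution $f$ of $(\tau-z)f=g$ with $f(a)=d_1$ and $f^{[1]}(a)=d_2$. If moreover the measures are real-valued and $g,d_1,d_2,z$ are real, then this solution is real. The analogous statements hold at the endpoint $b$.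
   Context: For a locally finite complex Borel measure $\mu$ on $(a,b)$: $\int_c^x h\,d\mu=\int_{[c,x)}h\,d\mu$ if $x>c$, $0$ if $x=c$, $-\int_{[x,c)}h\,d\mu$ if $x<c$. $AC_{loc}((a,b);\mu)$ is the set of functions $f(x)=f(c)+\int_c^x h\,d\mu$ with $h\in L^1_{loc}((a,b);|\mu|)$, $h=\frac{df}{d\mu}$. $\mathfrak{D}_\tau$ is the set of $f\in AC_{loc}((a,b);\varsigma)$ for which there is $F\in AC_{loc}((a,b);\varrho)$ with $F(x)=-\frac{df}{d\varsigma}(x)+\int_c^x f\,d\chi$ for $|\varsigma|$-a.e. $x$; $F$ is unique, $\tau f:=\frac{dF}{d\varrho}$, and $f^{[1]}(x):=\int_c^x f\,d\chi-F(x)$. ''$(\tau-z)f=g$'' means $\tau f-zf=g$ $|\varrho|$-a.e. *)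

(* Defs.v *)
From HB Require Import structures.
From mathcomp Require Import all_boot all_order all_algebra.
From mathcomp Require Import all_classical all_reals all_analysis.
From mathcomp Require Import complex.
Set Implicit Arguments. Unset Strict Implicit. Unset Printing Implicit Defensive.
Import Order.TTheory GRing.Theory Num.Theory.
Local Open Scope classical_set_scope.
Local Open Scope ring_scope.

(* Locally finite complex Borel measures on (a,b), in polar form.            *)
(* A complex Borel measure mu on (a,b) is represented by its total variation *)
(* |mu| = cm_var mu (a positive Borel measure on R; only its trace on (a,b)  *)
(* matters) together with its polar density cm_dens mu = d mu / d|mu|,      *)
(* a Borel function of modulus 1, so that mu(A) = int_A cm_dens d|mu|.       *)

Record cmeasure (R : realType) := CMeasure {
  cm_var : {measure set R -> \bar R};
  cm_dens : R -> R[i] }.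

Section Defs.
Variable R : realType.
Local Open Scope complex_scope.

Definition oitv (a b : \bar R) : set R := [set x | (a < x%:E)%E /\ (x%:E < b)%E].

Definition cmeasurable_on (D : set R) (h : R -> R[i]) :=
  measurable_fun D (fun x => complex.Re (h x)) /\ measurable_fun D (fun x => complex.Im (h x)).

Definition cintegrable (lam : {measure set R -> \bar R}) (D : set R)
    (h : R -> R[i]) :=
  lam.-integrable D (fun x => (complex.Re (h x))%:E) /\
  lam.-integrable D (fun x => (complex.Im (h x))%:E).

Definition cint_pos (lam : {measure set R -> \bar R}) (D : set R)
    (h : R -> R[i]) : R[i] :=
  Complex (Rintegral lam D (fun x => complex.Re (h x)))
          (Rintegral lam D (fun x => complex.Im (h x))).

Definition cint (mu : cmeasure R) (D : set R) (h : R -> R[i]) : R[i] :=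
  cint_pos (cm_var mu) D (fun x => h x * cm_dens mu x).

Definition cmeas (mu : cmeasure R) (A : set R) : R[i] :=
  cint mu A (fun _ => 1).

Definition lf_cmeasure (a b : \bar R) (mu : cmeasure R) :=
  cmeasurable_on (oitv a b) (cm_dens mu) /\
  (forall x, oitv a b x -> Normc.normc (cm_dens mu x) = 1) /\
  (forall al be, oitv a b al -> oitv a b be ->
     (cm_var mu `[al, be]%classic < +oo)%E).

Definition real_cmeasure (a b : \bar R) (mu : cmeasure R) :=
  {ae cm_var mu, forall x, oitv a b x -> complex.Im (cm_dens mu x) = 0}.

Definition csupp (a b : \bar R) (mu : cmeasure R) : set R :=
  [set x | oitv a b x /\ forall e : R, 0 < e ->
     (0 < cm_var mu [set y | oitv a b y /\ (`|y - x| < e)%R])%E].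

Definition L1loc (a b : \bar R) (mu : cmeasure R) (h : R -> R[i]) :=
  cmeasurable_on (oitv a b) h /\
  forall al be, oitv a b al -> oitv a b be -> cintegrable (cm_var mu) `[al, be]%classic h.

Definition cint_from (mu : cmeasure R) (c x : R) (h : R -> R[i]) : R[i] :=
  if c < x then cint mu [set y | c <= y /\ y < x] h
  else if x == c then 0
  else - cint mu [set y | x <= y /\ y < c] h.

Definition AC_deriv (a b : \bar R) (mu : cmeasure R) (c : R)
    (f h : R -> R[i]) :=
  L1loc a b mu h /\ forall x, oitv a b x -> f x = f c + cint_from mu c x h.

(* f in D_tau, F is the (unique) function of the definition of D_tau,
   and (tau - z) f = g holds |varrho|-a.e. *)
Definition solves_with (a b : \bar R) (rho vs chi : cmeasure R) (c : R)
    (z : R[i]) (g f F : R -> R[i]) :=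
  exists hf H : R -> R[i],
    [/\ AC_deriv a b vs c f hf,
        AC_deriv a b rho c F H,
        {ae cm_var vs, forall x, oitv a b x ->
           F x = - hf x + cint_from chi c x f} &
        {ae cm_var rho, forall x, oitv a b x -> H x - z * f x = g x}].

Definition qderiv (chi : cmeasure R) (c : R) (f F : R -> R[i]) : R -> R[i] :=
  fun x => cint_from chi c x f - F x.

Definition lim_at_left_end (a b : \bar R) (f : R -> R[i]) (d : R[i]) :=
  forall e : R, 0 < e -> exists al, oitv a b al /\
    forall x, (a < x%:E)%E -> x < al -> Normc.normc (f x - d) < e.

Definition lim_at_right_end (a b : \bar R) (f : R -> R[i]) (d : R[i]) :=
  forall e : R, 0 < e -> exists be, oitv a b be /\
    forall x, be < x -> (x%:E < b)%E -> Normc.normc (f x - d) < e.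

End Defs.

(* Main.v *)
Require Import Defs.
From HB Require Import structures.
From mathcomp Require Import all_boot all_order all_algebra.
From mathcomp Require Import all_classical all_reals all_analysis.
From mathcomp Require Import complex.
From mathcomp Require Import measurable_realfun.
From mathcomp Require Import ring lra.
Set Implicit Arguments. Unset Strict Implicit. Unset Printing Implicit Defensive.
Import Order.TTheory GRing.Theory Num.Theory.
Import numFieldNormedType.Exports.
Local Open Scope classical_set_scope.
Local Open Scope ring_scope.
Local Open Scope complex_scope.

(** Let p = f^[1]. In terms of (f, p) the equation is a first-order system:
    f has density p with respect to vs, and p is the sum of a constant, an
    integral of f against chi and minus an integral of z f + g against rho.
    Integrating from the regular endpoint gives a Volterra system over the
    segments between the endpoint and x.  Over open segments it is solved by
    successive approximations: weighting functions by K ^ floor(4 k m(x)), where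
    m(x) is the mass of the segment, makes the integral operator a contraction
    even in the presence of atoms.  With left-continuous primitives the segments
    are open at the endpoint a but contain x at the endpoint b; the two systems
    are equivalent because vs has no atom in common with rho or chi, so that
    including x changes f (resp. p) on a null set of rho and chi (resp. vs).
    Reality follows from uniqueness by conjugation. *)

(** An element of D_tau is described by integrals from an interior point [c], so a solution is at
    first only known to be bounded on compact subintervals. The Volterra system integrates [f] and
    [p] from the endpoint itself and makes sense only once they are integrable up to it. This is
    obtained from boundedness near the endpoint, which needs its own argument, because successive
    approximation works inside the class of bounded functions and says nothing about a solution that
    might lie outside it. Open segments matter for the contraction because an atom at x, however
    large, would otherwise multiply the unknown at x by its full mass, and a weight evaluated at the
    same point x cannot compensate for that. A boolean [l] selects the endpoint, so that each
    argument is given once: the order, the segments and the sign of the integrals depend on it. *)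

(** * Complex integrals against measures in polar form *)

Section ComplexIntegral.
Variable R : realType.
Implicit Types (mu : cmeasure R) (D : set R) (h : R -> R[i]).

Lemma ReD (x y : R[i]) : complex.Re (x + y) = complex.Re x + complex.Re y.
Proof. by case: x; case: y. Qed.
Lemma ImD (x y : R[i]) : complex.Im (x + y) = complex.Im x + complex.Im y.
Proof. by case: x; case: y. Qed.
Lemma ReN (x : R[i]) : complex.Re (- x) = - complex.Re x.
Proof. by case: x. Qed.
Lemma ImN (x : R[i]) : complex.Im (- x) = - complex.Im x.
Proof. by case: x. Qed.
Lemma ReM (x y : R[i]) : complex.Re (x * y) =
  complex.Re x * complex.Re y - complex.Im x * complex.Im y.
Proof. by case: x => a b; case: y => c d. Qed.
Lemma ImM (x y : R[i]) : complex.Im (x * y) =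
  complex.Re x * complex.Im y + complex.Im x * complex.Re y.
Proof. by case: x => a b; case: y => c d. Qed.
Lemma complex_ext (x y : R[i]) :
  complex.Re x = complex.Re y -> complex.Im x = complex.Im y -> x = y.
Proof. by case: x; case: y => a b c d /= -> ->. Qed.

(* Unlike Normc.normc, this equivalent norm is measurable and integrable
   without any result on square roots; it is still submultiplicative. *)
Definition abs1 (w : R[i]) : R := `|complex.Re w| + `|complex.Im w|.

Lemma abs1_ge0 w : 0 <= abs1 w.
Proof. exact: addr_ge0. Qed.
Lemma abs1_0 : abs1 0 = 0.
Proof. by rewrite /abs1 /= normr0 addr0. Qed.
Lemma abs1D x y : abs1 (x + y) <= abs1 x + abs1 y.
Proof.
rewrite /abs1 ReD ImD.
have := ler_normD (complex.Re x) (complex.Re y).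
have := ler_normD (complex.Im x) (complex.Im y); lra.
Qed.
Lemma abs1N x : abs1 (- x) = abs1 x.
Proof. by rewrite /abs1 ReN ImN !normrN. Qed.
Lemma abs1B x y : abs1 (x - y) <= abs1 x + abs1 y.
Proof. by rewrite -(abs1N y); exact: abs1D. Qed.
Lemma abs1M x y : abs1 (x * y) <= abs1 x * abs1 y.
Proof.
rewrite /abs1 ReM ImM.
have := ler_normB (complex.Re x * complex.Re y) (complex.Im x * complex.Im y).
have := ler_normD (complex.Re x * complex.Im y) (complex.Im x * complex.Re y).
rewrite !normrM; lra.
Qed.
Lemma abs1_eq0 x : abs1 x <= 0 -> x = 0.
Proof.
rewrite /abs1 => h; have h1 := normr_ge0 (complex.Re x).
have h2 := normr_ge0 (complex.Im x).
apply: complex_ext => /=; apply/eqP; rewrite -normr_le0; lra.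
Qed.
Lemma normc_le_abs1 (x : R[i]) : Normc.normc x <= abs1 x.
Proof.
case: x => a b; rewrite /abs1 /=.
rewrite -[leRHS]ger0_norm ?addr_ge0 // -sqrtr_sqr ler_sqrt ?sqr_ge0 //.
rewrite -[a ^+ 2]real_normK ?num_real // -[b ^+ 2]real_normK ?num_real //.
have := mulr_ge0 (normr_ge0 a) (normr_ge0 b); nra.
Qed.
Lemma Re_le_normc (x : R[i]) : `|complex.Re x| <= Normc.normc x.
Proof.
case: x => a b /=; rewrite -sqrtr_sqr ler_sqrt ?addr_ge0 ?sqr_ge0 //.
by rewrite lerDl sqr_ge0.
Qed.
Lemma Im_le_normc (x : R[i]) : `|complex.Im x| <= Normc.normc x.
Proof.
case: x => a b /=; rewrite -sqrtr_sqr ler_sqrt ?addr_ge0 ?sqr_ge0 //.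
by rewrite lerDr sqr_ge0.
Qed.
Lemma abs1_le_normc x : abs1 x <= 2 * Normc.normc x.
Proof. by have := Re_le_normc x; have := Im_le_normc x; rewrite /abs1; lra. Qed.

(** The density has modulus 1 for [Normc.normc], whereas its [abs1] may exceed 1. Passing through
    [Normc.normc] therefore avoids the loss that [abs1M] would cause. *)
Lemma ReM_unit (x y : R[i]) : Normc.normc y = 1 -> `|complex.Re (x * y)| <= abs1 x.
Proof.
by move=> y1; rewrite (le_trans (Re_le_normc _))// Normc.normcM y1 mulr1 normc_le_abs1.
Qed.
Lemma ImM_unit (x y : R[i]) : Normc.normc y = 1 -> `|complex.Im (x * y)| <= abs1 x.
Proof.
by move=> y1; rewrite (le_trans (Im_le_normc _))// Normc.normcM y1 mulr1 normc_le_abs1.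
Qed.

Lemma cmeasurable_onS D D' h : measurable D' -> D `<=` D' ->
  cmeasurable_on D' h -> cmeasurable_on D h.
Proof. by move=> mD' DD' [h1 h2]; split;
  exact: measurable_funS h1 || exact: measurable_funS h2.
Qed.

Lemma eq_cmeasurable_on D h h' : (forall x, D x -> h x = h' x) ->
  cmeasurable_on D h -> cmeasurable_on D h'.
Proof.
move=> e [h1 h2]; split; [apply: eq_measurable_fun h1|apply: eq_measurable_fun h2];
  by move=> x; rewrite inE => /e ->.
Qed.

Lemma cmeasurable_on_cst D w : cmeasurable_on D (fun=> w).
Proof. by split; exact: measurable_cst. Qed.

Lemma cmeasurable_onD D h h' : cmeasurable_on D h -> cmeasurable_on D h' ->
  cmeasurable_on D (fun x => h x + h' x).
Proof.
move=> [h1 h2] [h3 h4]; split.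
  by under eq_fun do rewrite ReD; exact: measurable_funD.
by under eq_fun do rewrite ImD; exact: measurable_funD.
Qed.

Lemma cmeasurable_onN D h : cmeasurable_on D h -> cmeasurable_on D (fun x => - h x).
Proof.
move=> [h1 h2]; split.
  by under eq_fun do rewrite ReN; exact: measurableT_comp.
by under eq_fun do rewrite ImN; exact: measurableT_comp.
Qed.

Lemma cmeasurable_onB D h h' : cmeasurable_on D h -> cmeasurable_on D h' ->
  cmeasurable_on D (fun x => h x - h' x).
Proof. by move=> mh mh'; apply: cmeasurable_onD => //; exact: cmeasurable_onN. Qed.

Lemma cmeasurable_onM D h h' : cmeasurable_on D h -> cmeasurable_on D h' ->
  cmeasurable_on D (fun x => h x * h' x).
Proof.
move=> [h1 h2] [h3 h4]; split.
  by under eq_fun do rewrite ReM; apply: measurable_funB; exact: measurable_funM.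
by under eq_fun do rewrite ImM; apply: measurable_funD; exact: measurable_funM.
Qed.

Lemma measurable_abs1 D h : cmeasurable_on D h -> measurable_fun D (fun x => abs1 (h x)).
Proof. by move=> [h1 h2]; apply: measurable_funD; exact: measurableT_comp. Qed.

Section pos.
Variables (lam : {measure set R -> \bar R}) (D : set R).
Hypothesis mD : measurable D.

(** Reduces integrability to one nonnegative function, to which domination applies directly. *)
Lemma cintegrableP h : cmeasurable_on D h ->
  cintegrable lam D h <-> lam.-integrable D (fun x => (abs1 (h x))%:E).
Proof.
move=> mh; have [mh1 mh2] := mh; split.
  move=> [i1 i2]; rewrite /abs1.
  have -> : (fun x => (`|complex.Re (h x)| + `|complex.Im (h x)|)%:E) =
    ((fun x => `|(complex.Re (h x))%:E|) \+ (fun x => `|(complex.Im (h x))%:E|))%E by [].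
  by apply: integrableD => //; exact: integrable_abse.
move=> i; split; apply: (le_integrable mD _ _ i); try exact/measurable_EFinP.
  by move=> x _; rewrite /= lee_fin [leRHS]ger0_norm ?abs1_ge0 // lerDl.
by move=> x _; rewrite /= lee_fin [leRHS]ger0_norm ?abs1_ge0 // lerDr.
Qed.

Lemma cintegrable_bounded h C : (lam D < +oo)%E -> cmeasurable_on D h ->
  (forall x, D x -> abs1 (h x) <= C) -> cintegrable lam D h.
Proof.
move=> fD mh hC; apply/cintegrableP => //.
apply: (measurable_bounded_integrable mD fD); first exact: measurable_abs1.
exists C; split; first exact: num_real.
by move=> M CM x Dx; rewrite /= ger0_norm ?abs1_ge0 // (le_trans (hC _ Dx)) // ltW.
Qed.

Lemma cintegrable_measurable h : cintegrable lam D h -> cmeasurable_on D h.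
Proof.
by move=> [/measurable_int/measurable_EFinP h1 /measurable_int/measurable_EFinP h2].
Qed.

Lemma cintegrableD h h' : cintegrable lam D h -> cintegrable lam D h' ->
  cintegrable lam D (fun x => h x + h' x).
Proof.
move=> [h1 h2] [h3 h4]; split.
  under eq_fun do rewrite ReD EFinD; exact: integrableD.
under eq_fun do rewrite ImD EFinD; exact: integrableD.
Qed.

Lemma cintegrableZ h w : cintegrable lam D h -> cintegrable lam D (fun x => w * h x).
Proof.
move=> ih; have mh := cintegrable_measurable ih; have := ih.
move=> /(cintegrableP mh) i.
have mwh : cmeasurable_on D (fun x => w * h x).
  by apply: cmeasurable_onM => //; exact: cmeasurable_on_cst.
apply/(cintegrableP mwh); apply: (le_integrable mD _ _ (integrableZl mD (abs1 w) i)).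
  by apply/measurable_EFinP; exact: measurable_abs1.
move=> x _ /=; rewrite lee_fin ger0_norm ?abs1_ge0 // [leRHS]ger0_norm ?mulr_ge0 ?abs1_ge0 //.
exact: abs1M.
Qed.

Lemma cint_posD h h' : cintegrable lam D h -> cintegrable lam D h' ->
  cint_pos lam D (fun x => h x + h' x) = cint_pos lam D h + cint_pos lam D h'.
Proof.
move=> [h1 h2] [h3 h4]; apply: complex_ext; rewrite ?ReD ?ImD /= -RintegralD //.
  by apply: eq_Rintegral => x _; rewrite ReD.
by apply: eq_Rintegral => x _; rewrite ImD.
Qed.

Lemma cint_posZ h w : cintegrable lam D h ->
  cint_pos lam D (fun x => w * h x) = w * cint_pos lam D h.
Proof.
move=> [h1 h2]; apply: complex_ext; rewrite ?ReM ?ImM /=.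
  rewrite -!RintegralZl // -RintegralB //; first by
    apply: eq_Rintegral => x _; rewrite ReM.
  - exact: (integrableZl mD (complex.Re w) h1).
  - exact: (integrableZl mD (complex.Im w) h2).
rewrite -!RintegralZl // -RintegralD //; first by
    apply: eq_Rintegral => x _; rewrite ImM.
- exact: (integrableZl mD (complex.Re w) h2).
- exact: (integrableZl mD (complex.Im w) h1).
Qed.

End pos.

Lemma cintegrableS lam D D' h : measurable D -> measurable D' -> D' `<=` D ->
  cintegrable lam D h -> cintegrable lam D' h.
Proof.
by move=> mD mD' DD' [h1 h2]; split; exact: integrableS h1 || exact: integrableS h2.
Qed.

Definition polar_on D mu := cmeasurable_on D (cm_dens mu) /\
  (forall x, D x -> Normc.normc (cm_dens mu x) = 1).

Lemma polar_onS D D' mu : measurable D' -> D `<=` D' -> polar_on D' mu -> polar_on D mu.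
Proof.
by move=> mD' DD' [h1 h2]; split => [|x /DD' /h2//]; exact: cmeasurable_onS h1.
Qed.

Section cint.
Variables (mu : cmeasure R) (D : set R).
Hypotheses (mD : measurable D) (pD : polar_on D mu).

Lemma cintegrable_dens h : cintegrable (cm_var mu) D h ->
  cintegrable (cm_var mu) D (fun x => h x * cm_dens mu x).
Proof.
move=> ih; have mh := cintegrable_measurable ih.
have mhd : cmeasurable_on D (fun x => h x * cm_dens mu x).
  by apply: cmeasurable_onM => //; case: pD.
have /(cintegrableP _ mD mh) i := ih.
split; apply: (le_integrable mD _ _ i); try by apply/measurable_EFinP; case: mhd.
  move=> x Dx /=; rewrite lee_fin [leRHS]ger0_norm ?abs1_ge0 //.
  by apply: ReM_unit; apply pD.
move=> x Dx /=; rewrite lee_fin [leRHS]ger0_norm ?abs1_ge0 //.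
by apply: ImM_unit; apply pD.
Qed.

Lemma cintD h h' : cintegrable (cm_var mu) D h -> cintegrable (cm_var mu) D h' ->
  cint mu D (fun x => h x + h' x) = cint mu D h + cint mu D h'.
Proof.
move=> ih ih'; rewrite /cint; under [X in cint_pos _ _ X]eq_fun do rewrite mulrDl.
by rewrite cint_posD //; exact: cintegrable_dens.
Qed.

Lemma cintZ h w : cintegrable (cm_var mu) D h ->
  cint mu D (fun x => w * h x) = w * cint mu D h.
Proof.
move=> ih; rewrite /cint; under [X in cint_pos _ _ X]eq_fun do rewrite -mulrA.
by rewrite cint_posZ //; exact: cintegrable_dens.
Qed.

Lemma cintB h h' : cintegrable (cm_var mu) D h -> cintegrable (cm_var mu) D h' ->
  cint mu D (fun x => h x - h' x) = cint mu D h - cint mu D h'.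
Proof.
move=> ih ih'; under [X in cint _ _ X]eq_fun do rewrite -mulN1r.
by rewrite cintD ?cintZ ?mulN1r //; exact: cintegrableZ.
Qed.

Lemma eq_cint h h' : (forall x, D x -> h x = h' x) -> cint mu D h = cint mu D h'.
Proof.
by move=> e; rewrite /cint /cint_pos; congr Complex; apply: eq_Rintegral => x;
  rewrite inE => Dx; rewrite e.
Qed.

Lemma ae_eq_cint_pos h h' : cmeasurable_on D h -> cmeasurable_on D h' ->
  {ae cm_var mu, forall x, D x -> h x = h' x} ->
  cint_pos (cm_var mu) D h = cint_pos (cm_var mu) D h'.
Proof.
move=> [h1 h2] [h3 h4] e; rewrite /cint_pos /Rintegral; congr (Complex (fine _) (fine _)).
  apply: ae_eq_integral => //; try exact/measurable_EFinP.
  by apply: filterS e => x /= e Dx; rewrite e.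
apply: ae_eq_integral => //; try exact/measurable_EFinP.
by apply: filterS e => x /= e Dx; rewrite e.
Qed.

Lemma ae_eq_cint h h' : cmeasurable_on D h -> cmeasurable_on D h' ->
  {ae cm_var mu, forall x, D x -> h x = h' x} -> cint mu D h = cint mu D h'.
Proof.
move=> mh mh' e; apply: ae_eq_cint_pos; try by apply: cmeasurable_onM => //; case: pD.
by apply: filterS e => x /= e Dx; rewrite e.
Qed.

(** The real and the imaginary part of the integrand are each dominated by [abs1 (h x)], whence the
    factor 2. It reappears in all later constants. *)
Lemma abs1_cint_le h : cintegrable (cm_var mu) D h ->
  ((abs1 (cint mu D h))%:E <= 2%:E * \int[cm_var mu]_(x in D) (abs1 (h x))%:E)%E.
Proof.
move=> ih; have mh := cintegrable_measurable ih.
have [i1 i2] := cintegrable_dens ih.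
have mhd : cmeasurable_on D (fun x => h x * cm_dens mu x).
  by apply: cmeasurable_onM => //; case: pD.
have -> : (2%:E = 1 + 1 :> \bar R)%E by rewrite -EFinD.
rewrite ge0_muleDl // !mul1e [in leLHS]/abs1 EFinD.
apply: leeD; rewrite EFin_normr_Rintegral //.
  apply: (le_trans (le_abse_integral _ _ _)) => //; first exact: measurable_int i1.
  apply: ge0_le_integral => //.
  - by apply/measurable_EFinP; apply: measurableT_comp => //; case: mhd.
  - by apply/measurable_EFinP; exact: measurable_abs1.
  - by move=> x Dx; rewrite lee_fin; apply: ReM_unit; apply pD.
apply: (le_trans (le_abse_integral _ _ _)) => //; first exact: measurable_int i2.
apply: ge0_le_integral => //.
- by apply/measurable_EFinP; apply: measurableT_comp => //; case: mhd.
- by apply/measurable_EFinP; exact: measurable_abs1.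
- by move=> x Dx; rewrite lee_fin; apply: ImM_unit; apply pD.
Qed.

Lemma abs1_cint_bounded h C : (cm_var mu D < +oo)%E -> cmeasurable_on D h ->
  (forall x, D x -> abs1 (h x) <= C) ->
  abs1 (cint mu D h) <= 2 * C * fine (cm_var mu D).
Proof.
move=> fD mh hC; rewrite -lee_fin; apply: (le_trans (abs1_cint_le _)).
  exact: cintegrable_bounded hC.
rewrite -mulrA EFinM lee_wpmul2l // EFinM fineK ?ge0_fin_numE // -integral_cst //.
apply: ge0_le_integral => //.
- by move=> x Dx; rewrite lee_fin abs1_ge0.
- by apply/measurable_EFinP; exact: measurable_abs1.
Qed.

Lemma cint_null h : cmeasurable_on D h -> cm_var mu D = 0%E -> cint mu D h = 0.
Proof.
move=> mh D0; have [] : cmeasurable_on D (fun x => h x * cm_dens mu x).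
  by apply: cmeasurable_onM => //; case: pD.
move=> /measurable_EFinP h1 /measurable_EFinP h2.
by rewrite /cint /cint_pos /Rintegral !null_set_integral.
Qed.

End cint.

Lemma cint_set0 mu h : cint mu set0 h = 0.
Proof. by rewrite /cint /cint_pos !Rintegral_set0. Qed.

Lemma cintU mu D D' h : measurable D -> measurable D' -> polar_on (D `|` D') mu ->
  cintegrable (cm_var mu) (D `|` D') h -> D `&` D' = set0 ->
  cint mu (D `|` D') h = cint mu D h + cint mu D' h.
Proof.
move=> mD mD' pD ih dD.
have dD' : [disjoint D & D'] by apply/disj_set2P.
have [i1 i2] := cintegrable_dens (measurableU _ _ mD mD') pD ih.
apply: complex_ext; rewrite ?ReD ?ImD /=; exact: Rintegral_setU.
Qed.

End ComplexIntegral.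

(** * Segments between a point and the chosen endpoint *)

Section Segments.
Variables (R : realType) (a b : \bar R).
Implicit Types (l : bool) (x y : R).
Notation I := (oitv a b).

(** [l = true] stands for the endpoint a and [l = false] for b: y lies strictly on the endpoint's
    side of x. *)
Definition before l y x := if l then y < x else x < y.
Definition seg l x : set R := [set y | I y /\ before l y x].
(** The segments dictated by the half-open convention of [cint_from]: (a,x) at the endpoint a, where
    this is the same as [seg], but [x,b) at the endpoint b. *)
Definition cseg l x : set R := [set y | I y /\ if l then y < x else x <= y].

Lemma oitv_is_interval : is_interval I.
Proof.
move=> x y [ax xb] [ay yb] t /andP[xt ty]; split.
  by rewrite (lt_le_trans ax) // lee_fin.
by rewrite (le_lt_trans _ yb) // lee_fin.
Qed.

Lemma measurable_oitv : measurable I.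
Proof. exact: is_interval_measurable oitv_is_interval. Qed.

Lemma seg_sub l x : seg l x `<=` I. Proof. by move=> y []. Qed.
Lemma cseg_sub l x : cseg l x `<=` I. Proof. by move=> y []. Qed.

Lemma measurable_seg l x : measurable (seg l x).
Proof.
apply: is_interval_measurable => y y' [Iy yx] [Iy' y'x] t /andP[yt ty].
split; first by apply: (oitv_is_interval Iy Iy'); rewrite yt.
move: l yx y'x => [] /= yx y'x.
  exact: le_lt_trans y'x.
exact: lt_le_trans yt.
Qed.

Lemma measurable_cseg l x : measurable (cseg l x).
Proof.
apply: is_interval_measurable => y y' [Iy yx] [Iy' y'x] t /andP[yt ty].
split; first by apply: (oitv_is_interval Iy Iy'); rewrite yt.
move: l yx y'x => [] /= yx y'x.
  exact: le_lt_trans y'x.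
exact: le_trans yt.
Qed.

Lemma seg_sub_cseg l x : seg l x `<=` cseg l x.
Proof. by move=> y [Iy] yx; split => //; case: l yx => //=; exact: ltW. Qed.

Lemma csegW l x y : cseg l x y -> seg l x y \/ y = x.
Proof.
move=> [Iy]; case: l => [yx|]; first by left.
by rewrite le_eqVlt => /orP[/eqP|xy]; [right|left].
Qed.

Lemma seg_sub_seg l x y : seg l x y -> seg l y `<=` seg l x.
Proof.
move=> [_] + t [It]; case: l => /= xy yt; split => //=.
  exact: lt_trans xy.
exact: lt_trans yt.
Qed.

Lemma cseg_sub_seg l x y : seg l x y -> cseg l y `<=` seg l x.
Proof.
move=> xy t /csegW[|->//]; exact: seg_sub_seg.
Qed.

Lemma seg_irr l x : ~ seg l x x.
Proof. by move=> [_]; case: l => /=; rewrite ltxx. Qed.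

Lemma seg_total l x y : I x -> I y -> ~ seg l x y -> seg l x `<=` seg l y.
Proof.
move=> Ix Iy nxy t [It]; have : ~ before l y x by move=> h; apply: nxy.
case: l {nxy} => /= /negP; rewrite -leNgt => xy yt; split => //=.
  exact: lt_le_trans xy.
exact: le_lt_trans yt.
Qed.

Lemma seg_cmp l x y : I x -> I y -> [\/ seg l x y, seg l y x | x = y].
Proof.
move=> Ix Iy; case: (ltgtP x y) => xy; last by constructor 3.
  by case: l; [constructor 2|constructor 1].
by case: l; [constructor 1|constructor 2].
Qed.

Lemma oitv_pred x : I x -> exists2 y, I y & y < x.
Proof.
move=> [ax xb]; case: a ax => [r| |] //=.
  rewrite lte_fin => rx; exists ((r + x) / 2); last lra.
  split; first by rewrite lte_fin; lra.
  by apply: lt_trans xb; rewrite lte_fin; lra.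
move=> _; exists (x - 1); last lra.
by split; rewrite ?ltNyr //; apply: lt_trans xb; rewrite lte_fin; lra.
Qed.

Lemma oitv_succ x : I x -> exists2 y, I y & x < y.
Proof.
move=> [ax xb]; case: b xb => [r| |] //=.
  rewrite lte_fin => rx; exists ((r + x) / 2); last lra.
  split; last by rewrite lte_fin; lra.
  by apply: lt_trans ax _; rewrite lte_fin; lra.
move=> _; exists (x + 1); last lra.
by split; rewrite ?ltry //; apply: lt_trans ax _; rewrite lte_fin; lra.
Qed.

Lemma seg_next l x : I x -> exists2 y, I y & seg l y x.
Proof.
move=> Ix; case: l.
  by have [y Iy xy] := oitv_succ Ix; exists y.
by have [y Iy xy] := oitv_pred Ix; exists y.
Qed.

Lemma seg_prev l x : I x -> exists y, seg l x y.
Proof.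
move=> Ix; case: l.
  by have [y Iy xy] := oitv_pred Ix; exists y.
by have [y Iy xy] := oitv_succ Ix; exists y.
Qed.

Lemma itvcc_sub x y : I x -> I y -> `[x, y]%classic `<=` I.
Proof. by move=> Ix Iy t; rewrite /= in_itv /= => h; exact: (oitv_is_interval Ix Iy). Qed.

Lemma itvcc_sub_seg l x y : I x -> I y ->
  exists2 t, I t & `[x, y]%classic `<=` seg l t.
Proof.
move=> Ix Iy; have sub u : `[x, y]%classic u -> [/\ I u, x <= u & u <= y].
  move=> uxy; have Iu := itvcc_sub Ix Iy uxy.
  by move: uxy; rewrite /= in_itv /= => /andP[].
case: l.
  have [t It [_ yt]] := seg_next true Iy; exists t => // u /sub[Iu _ uy].
  by split => //; exact: le_lt_trans yt.
have [t It [_ tx]] := seg_next false Ix; exists t => // u /sub[Iu xu _].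
by split => //; exact: lt_le_trans xu.
Qed.

(* Rational points between consecutive elements, together with the first
   element of B if there is one, give a cofinal sequence. *)
Lemma coinitial_sequence l (B : set R) : B !=set0 -> B `<=` I ->
  exists2 u : nat -> R, (forall n, B (u n)) & forall y, B y -> exists n, ~ seg l (u n) y.
Proof.
move=> [y0 By0] BI.
pose below (q : rat) := [set y | B y /\ before l y (ratr q)].
pose first := [set y | B y /\ forall t, B t -> ~ before l t y].
pose u n := if n is k.+1 then
  if unpickle k is Some q then
    if pselect (exists y, below q y) is left p then projT1 (cid p) else y0
  else y0
  else if pselect (exists y, first y) is left p then projT1 (cid p) else y0.
exists u.
  case=> [|k] /=.
    by case: pselect => // p; case: (cid p) => y [].
  case: unpickle => // q; case: pselect => // p.
  by case: (cid p) => y [].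
move=> y By; have [fy|nfy] := pselect (first y).
  exists 0%N => /=; case: pselect => [p|np]; last by exfalso; apply: np; exists y.
  case: (cid p) => t [Bt ht] /= [_]; exact: ht.
have [t Bt ty] : exists2 t, B t & before l t y.
  apply: contrapT => h; apply: nfy; split => // t Bt ty; apply: h.
  by exists t.
have [q qt qy] : exists2 q : rat, before l t (ratr q) & ~ before l y (ratr q).
  case: l {first u below nfy} ty => /= ty.
    have [q] := rat_in_itvoo ty; rewrite in_itv /= => /andP[tq qy].
    by exists q => //; apply/negP; rewrite -leNgt ltW.
  have [q] := rat_in_itvoo ty; rewrite in_itv /= => /andP[yq qt].
  by exists q => //; apply/negP; rewrite -leNgt ltW.
exists (pickle q).+1 => /=; rewrite pickleK.
case: pselect => [p|np]; last by exfalso; apply: np; exists t.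
case: (cid p) => s [Bs sq] /= [_] ys; apply: qy.
by case: l ys sq {qt ty first u below nfy p} => /= ys sq;
  [apply: lt_trans ys sq|apply: lt_trans sq ys].
Qed.

Lemma measurable_mono (J : set R) (f : R -> R) : is_interval J ->
  (forall x y, J x -> J y -> x <= y -> f x <= f y) -> measurable_fun J f.
Proof.
move=> iJ fJ mJ.
apply: (measurability (@RGenCInfty.G R)) => //; first exact: RGenCInfty.measurableE.
move=> /= _ [_] [r] -> <-.
apply: is_interval_measurable => s t /=.
rewrite !in_itv/= !andbT => -[Js fs] [Jt ft] u /andP[su ut].
have Ju : J u by apply: (iJ _ _ Js Jt); rewrite su.
by split => //; rewrite /= in_itv/= andbT (le_trans fs) // fJ.
Qed.

Lemma measurable_anti (J : set R) (f : R -> R) : is_interval J ->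
  (forall x y, J x -> J y -> x <= y -> f y <= f x) -> measurable_fun J f.
Proof.
move=> iJ fJ; rewrite -(opprK f); apply: measurableT_comp => //.
by apply: measurable_mono => // x y Jx Jy xy; rewrite lerN2 fJ.
Qed.

(** Both directions are needed: segments grow with x at the endpoint a and shrink at the endpoint
    b. *)
Definition monotone_family (J : set R) (D : R -> set R) :=
  (forall x y, J x -> J y -> x <= y -> D x `<=` D y) \/
  (forall x y, J x -> J y -> x <= y -> D y `<=` D x).

(** For a nonnegative integrand the integral over a monotone family is a monotone function of x,
    hence measurable. The general case follows by writing r = (|r| + r) - |r|. *)
Lemma measurable_Rintegral (lam : {measure set R -> \bar R}) (J : set R)
    (D : R -> set R) (r : R -> R) : is_interval J -> monotone_family J D ->
  (forall x, J x -> measurable (D x) /\ lam.-integrable (D x) (EFin \o r)) ->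
  measurable_fun J (fun x => Rintegral lam (D x) r).
Proof.
move=> iJ mon iD.
have pos (p : R -> R) : (forall x, 0 <= p x) ->
    (forall x, J x -> lam.-integrable (D x) (EFin \o p)) ->
    measurable_fun J (fun x => Rintegral lam (D x) p).
  move=> p0 ip.
  have le x y : J x -> J y -> D x `<=` D y ->
      Rintegral lam (D x) p <= Rintegral lam (D y) p.
    move=> Jx Jy xy; apply: fine_le.
    - by have [m _] := iD _ Jx; have := integrable_fin_num m (ip _ Jx).
    - by have [m _] := iD _ Jy; have := integrable_fin_num m (ip _ Jy).
    - have [mx _] := iD _ Jx; have [my _] := iD _ Jy.
      apply: (ge0_subset_integral _ mx my (measurable_int _ (ip y Jy)) _ xy).
      by move=> t _; rewrite lee_fin.
  case: mon => mon.
    by apply: measurable_mono => // x y Jx Jy xy; apply: le => //; exact: mon.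
  by apply: measurable_anti => // x y Jx Jy xy; apply: le => //; exact: mon.
have ia x : J x -> lam.-integrable (D x) (EFin \o (fun t => `|r t|)).
  by move=> Jx; have [_ i] := iD _ Jx; exact: integrable_abse i.
have isum x : J x -> lam.-integrable (D x) (EFin \o (fun t => `|r t| + r t)).
  by move=> Jx; have [m i] := iD _ Jx; have := integrableD m (ia _ Jx) i.
apply: (@eq_measurable_fun _ _ _ _ _ (fun x => Rintegral lam (D x) (fun t => `|r t| + r t)
   - Rintegral lam (D x) (fun t => `|r t|))).
  move=> x; rewrite inE => Jx; have [m i] := iD _ Jx.
  by rewrite (RintegralD m (ia _ Jx) i) addrAC subrr add0r.
apply: measurable_funB; apply: pos => //.
by move=> x; have := ler_norm (- r x); rewrite normrN; lra.
Qed.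

Lemma cmeasurable_cint (mu : cmeasure R) (J : set R) (D : R -> set R) h :
  is_interval J -> monotone_family J D ->
  (forall x, J x -> [/\ measurable (D x), polar_on (D x) mu & cintegrable (cm_var mu) (D x) h]) ->
  cmeasurable_on J (fun x => cint mu (D x) h).
Proof.
move=> iJ mon iD; split; apply: measurable_Rintegral => // x Jx;
  have [m p i] := iD _ Jx; split => //; by have [] := cintegrable_dens m p i.
Qed.

Lemma seg_monotone l J : monotone_family J (seg l).
Proof.
case: l; [left|right] => x y _ _ xy t [It]; split => //=.
  exact: lt_le_trans xy.
exact: le_lt_trans xy _.
Qed.

Lemma cseg_monotone l J : monotone_family J (cseg l).
Proof.
case: l; [left|right] => x y _ _ xy t [It] h; split => //=.
  exact: lt_le_trans xy.
exact: le_trans h.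
Qed.

(** The sets are nested but not in the order of their indices. A finite union of members of a chain
    is again a member, so continuity from below applies to the partial unions. *)
Lemma chain_measure_le (lam : {measure set R -> \bar R}) (A : nat -> set R) (C : \bar R) :
  (forall n, measurable (A n)) -> (forall n m, A n `<=` A m \/ A m `<=` A n) ->
  (forall n, (lam (A n) <= C)%E) -> (lam (\bigcup_n A n) <= C)%E.
Proof.
move=> mA ch AC.
pose F n := \big[setU/set0]_(i < n.+1) A i.
have FA n : exists k, F n = A k.
  elim: n => [|n [k ih]]; first by exists 0%N; rewrite /F big_ord_recr big_ord0 /= set0U.
  rewrite /F big_ord_recr /= -/(F n) ih.
  case: (ch k n.+1) => h; [exists n.+1|exists k]; apply/seteqP; split => x;
    rewrite /setU /=; tauto || by move=> [|]//; exact: h.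
have UF : \bigcup_n A n = \bigcup_n F n.
  rewrite -(@bigcup_bigsetU_bigcup _ A); apply/seteqP; split.
    by move=> x [n _ h]; exists n.
  by move=> x [n _ h]; exists n.
have mF n : measurable (F n) by have [k ->] := FA n.
rewrite UF.
have cv : (lam \o F) x @[x --> \oo] --> lam (\bigcup_n F n).
  apply: nondecreasing_cvg_mu => //; first exact: bigcup_measurable.
  move=> n m nm; apply/subsetPset; exact: subset_bigsetU.
rewrite -(cvg_lim _ cv) //; apply: lime_le; first by apply/cvg_ex; eexists; exact: cv.
by apply: nearW => n /=; have [k ->] := FA n.
Qed.

(** The endpoint is not in the interval, so the segments shrink to the empty set. If all had mass at
    least e, their complements in [seg l c] would form a chain exhausting it with mass at most that
    of [seg l c] minus e. *)
Lemma seg_small l (lam : {measure set R -> \bar R}) (c : R) (e : R) : I c -> 0 < e ->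
  (lam (seg l c) < +oo)%E -> exists2 x, seg l c x & (lam (seg l x) < e%:E)%E.
Proof.
move=> Ic e0 fc.
have [u Bu hu] := coinitial_sequence l (seg_prev l Ic) (@seg_sub l c).
apply: contrapT => H.
have big n : (e%:E <= lam (seg l (u n)))%E.
  by rewrite leNgt; apply/negP => h; apply: H; exists (u n).
have lfin x : seg l c x -> lam (seg l x) \is a fin_num.
  move=> cx; rewrite ge0_fin_numE //; apply: le_lt_trans fc.
  apply: le_measure; rewrite ?inE; try exact: measurable_seg.
  exact: seg_sub_seg.
have : (lam (\bigcup_n (seg l c `\` seg l (u n))) <= lam (seg l c) - e%:E)%E.
  apply: chain_measure_le.
  - by move=> n; apply: measurableD; exact: measurable_seg.
  - move=> n m; have [s|s|->] := seg_cmp l (seg_sub (Bu n)) (seg_sub (Bu m)); last by left.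
      by left => t [ct nt]; split => // mt; apply: nt; exact: (seg_sub_seg s).
    by right => t [ct nt]; split => // mt; apply: nt; exact: (seg_sub_seg s).
  - move=> n; rewrite measureD //; try exact: measurable_seg.
    have -> : seg l c `&` seg l (u n) = seg l (u n).
      by apply/setIidPr; exact: seg_sub_seg.
    apply: leeB (lexx _) _; exact: big.
have -> : \bigcup_n (seg l c `\` seg l (u n)) = seg l c.
  apply/seteqP; split => [x [n _ []]//|x cx].
  by have [n hn] := hu _ cx; exists n.
apply/negP; rewrite -ltNge.
have /fineK <- : lam (seg l c) \is a fin_num by rewrite ge0_fin_numE.
by rewrite -EFinB lte_fin ltrBlDr ltrDl.
Qed.

End Segments.

(** * A Gronwall estimate for measures with atoms *)

Section Gronwall.
Variables (R : realType) (a b : \bar R) (l : bool) (lam : {measure set R -> \bar R}).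
Notation I := (oitv a b).
Notation seg := (seg a b l).
Hypothesis finlam : forall x, I x -> (lam (seg x) < +oo)%E.

Let m x := fine (lam (seg x)).

Let lamE x : I x -> lam (seg x) = (m x)%:E.
Proof. by move=> Ix; rewrite /m fineK // ge0_fin_numE // finlam. Qed.

Let m_ge0 x : 0 <= m x. Proof. exact: fine_ge0. Qed.

Let m_mono x y : I x -> seg x y -> m y <= m x.
Proof.
move=> Ix xy; rewrite -lee_fin -!lamE //; last exact: seg_sub xy.
by apply: le_measure; rewrite ?inE; [exact: measurable_seg..|exact: seg_sub_seg].
Qed.

Let measurable_m : measurable_fun I m.
Proof.
apply: (@eq_measurable_fun _ _ _ _ _ (fun x => Rintegral lam (seg x) (fun=> 1))).
  by move=> x _; rewrite Rintegral_cst ?mul1r //; exact: measurable_seg.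
apply: (measurable_Rintegral (@oitv_is_interval _ a b)); first exact: seg_monotone.
move=> x Ix; split; first exact: measurable_seg.
apply: (measurable_bounded_integrable (measurable_seg _ _ _ _) (finlam Ix)) => //.
by exists 1; split => // M M1 y _; rewrite /= normr1 ltW.
Qed.

Let upper x t := [set y | seg x y /\ t <= m y].

Let measurable_upper x t : measurable (upper x t).
Proof.
have -> : upper x t = seg x `&` (I `&` m @^-1` `[t, +oo[%classic).
  apply/seteqP; split => [y [xy ty]|y [xy [Iy]]].
    by split => //; split; [exact: seg_sub xy|rewrite /= in_itv /= andbT].
  by rewrite /= in_itv /= andbT.
apply: measurableI; first exact: measurable_seg.
apply: measurable_m; [exact: measurable_oitv|exact: measurable_itv].
Qed.

(** If y is in [upper x t], then the part of the set outside [seg y] has mass at most m x - m y <= m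
    x - t; letting y run through a coinitial sequence exhausts the set. Openness of the segments is
    essential: m y leaves out the atom at y, so a large atom of the set is paid for by the
    difference m x - m y. *)
Let upper_mass x t : I x -> t <= m x -> (lam (upper x t) <= (m x - t)%:E)%E.
Proof.
move=> Ix tx; have [->|/set0P B0] := eqVneq (upper x t) set0.
  by rewrite measure0 lee_fin subr_ge0.
have BI : upper x t `<=` I by move=> y [/seg_sub].
have [u Bu hu] := coinitial_sequence l B0 BI.
have xu n : seg x (u n) by case: (Bu n).
have sub n : upper x t `\` seg (u n) `<=` seg x `\` seg (u n) by move=> y [[]].
have -> : upper x t = \bigcup_n (upper x t `\` seg (u n)).
  apply/seteqP; split => [y By|y [n _ []]//].
  by have [n hn] := hu _ By; exists n.
have mD n : measurable (upper x t `\` seg (u n)).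
  by apply: measurableD => //; exact: measurable_seg.
apply: chain_measure_le => //.
  move=> n n'; have [s|s|->] := seg_cmp l (seg_sub (xu n)) (seg_sub (xu n')); last by left.
    by left => y [By ny]; split => // y'; apply: ny; exact: (seg_sub_seg s).
  by right => y [By ny]; split => // y'; apply: ny; exact: (seg_sub_seg s).
move=> n; apply: (@le_trans _ _ (lam (seg x `\` seg (u n)))).
  apply: le_measure; rewrite ?inE //.
  by apply: measurableD; exact: measurable_seg.
have -> : lam (seg x `\` seg (u n)) = (lam (seg x) - lam (seg (u n)))%E.
  rewrite measureD //; try exact: measurable_seg; last exact: finlam.
  congr (_ - lam _)%E; apply/setIidPr; exact: seg_sub_seg.
rewrite !lamE //; last exact: seg_sub (xu n).
by rewrite -EFinB lee_fin lerB //; case: (Bu n).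
Qed.

Let hseg x0 x := seg x0 x \/ x = x0.

(* The weight K ^ floor(4 k m(x)) with m(x) the mass of the segment below x
   makes the integral operator a contraction of ratio 1/2, whatever the atoms. *)
Lemma gronwall (k C x0 : R) (u : nat -> R -> R) :
  0 < k -> I x0 ->
  (forall n, measurable_fun I (u n)) -> (forall n x, 0 <= u n x) ->
  (forall x, hseg x0 x -> u 0%N x <= C) ->
  (forall n x, hseg x0 x ->
    ((u n.+1 x)%:E <= k%:E * \int[lam]_(y in seg x) (u n y)%:E)%E) ->
  exists2 M, 0 <= M & forall n x, hseg x0 x -> u n x <= M / 2 ^+ n.
Proof.
move=> k0 Ix0 mu u0 uC step.
have C0 : 0 <= C by apply: le_trans (uC x0 _); [exact: u0|right].
have hI x : hseg x0 x -> I x by move=> [/seg_sub|->].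
have hm x : hseg x0 x -> m x <= m x0 by move=> [/m_mono|->//]; apply.
(* The range of m is cut into levels of height 1 / (4 k); [i x] is the level of x. *)
pose i x := Num.truncn (4 * k * m x).
(* Since 4 k m(x) <= K, all points of strictly lower level together contribute at most a quarter;
   the summand 1 gives K >= 1. *)
pose K := 4 * k * m x0 + 1.
have m0 := m_ge0.
have km x : 0 <= 4 * k * m x by rewrite !mulr_ge0 // ltW.
have K1 : 1 <= K by rewrite /K lerDr.
have K0 : 0 < K by apply: lt_le_trans K1.
have main n x : hseg x0 x -> u n x <= C * K ^+ i x / 2 ^+ n.
  elim: n x => [|n ih] x hx.
    rewrite expr0 divr1 (le_trans (uC _ hx)) // ler_peMr //.
    by rewrite exprn_ege1.
  have Ix := hI _ hx.
  pose c := C / 2 ^+ n.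
  have c0 : 0 <= c by rewrite divr_ge0 // exprn_ge0.
  (* [q] bounds [u n] on the level of x, [p] on all lower levels; the aim is q / 2 for
     [u n.+1 x]. *)
  pose q := c * K ^+ i x; pose p := q / K.
  have q0 : 0 <= q by rewrite mulr_ge0 // exprn_ge0 // ltW.
  have p0 : 0 <= p by rewrite divr_ge0 // ltW.
  (* The mass at which the level of x begins: [upper x t] consists of the points of [seg x] on that
     level. *)
  pose t := (i x)%:R / (4 * k).
  have k4 : 0 < 4 * k by rewrite mulr_gt0.
  have tx : t <= m x.
    by rewrite ler_pdivrMr // mulrC; have /andP[] := truncn_itv (km x).
  have xt : m x - t <= (4 * k)^-1.
    rewrite -(ler_pM2l k4) mulrBr /t mulfV ?gt_eqF // mulrCA mulfV ?gt_eqF // mulr1.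
    have /andP[_ /ltW] := truncn_itv (km x); rewrite -/(i x) -natr1; lra.
  have bnd y : seg x y -> u n y <= p + q * \1_(upper x t) y.
    move=> xy; have hy : hseg x0 y.
      by case: hx xy => [s|->] xy; left => //; exact: (seg_sub_seg s).
    apply: (le_trans (ih _ hy)); rewrite mulrAC -/c indicE.
    have iyx : (i y <= i x)%N by apply: le_truncn; rewrite ler_pM2l // m_mono.
    have [uy|nuy] := pselect (upper x t y).
      rewrite mem_set // mulr1 (@le_trans _ _ q) ?lerDr //.
      by apply: ler_wpM2l => //; rewrite ler_weXn2l.
    rewrite memNset // mulr0 addr0 /p /q -mulrA; apply: ler_wpM2l => //.
    have lti : (i y < i x)%N.
      rewrite truncn_lt_nat // ltNge; apply/negP => h; apply: nuy; split => //.
      by rewrite ler_pdivrMr // mulrC.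
    rewrite ler_pdivlMr // -exprSr ler_weXn2l //.
  apply: (@le_trans _ _ (k * (p * m x + q * (m x - t)))).
    rewrite -lee_fin; apply: (le_trans (step _ _ hx)); rewrite EFinM.
    apply: lee_wpmul2l; first by rewrite lee_fin ltW.
    apply: (@le_trans _ _ (\int[lam]_(y in seg x) (p%:E + q%:E * (\1_(upper x t) y)%:E))%E).
      have mi : measurable_fun (seg x) (fun y => \1_(upper x t) y : R).
        exact: measurable_indic.
      apply: ge0_le_integral => //.
      - exact: measurable_seg.
      - by move=> y _; rewrite lee_fin.
      - apply/measurable_EFinP; apply: (measurable_funS _ (@seg_sub _ a b l x)) => //.
        exact: measurable_oitv.
      - have -> : (fun y => p%:E + q%:E * (\1_(upper x t) y)%:E)%E =
          EFin \o (fun y => p + q * \1_(upper x t) y) by [].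
        apply/measurable_EFinP; apply: measurable_funD => //.
        exact: measurable_funM.
    rewrite ge0_integralD //; last 3 first.
    - exact: measurable_seg.
    - by move=> y _; rewrite mule_ge0 // lee_fin.
    - have -> : (fun y => q%:E * (\1_(upper x t) y)%:E)%E =
          EFin \o (fun y => q * \1_(upper x t) y) by [].
      by apply/measurable_EFinP; apply: measurable_funM.
    rewrite integral_cst; last exact: measurable_seg.
    rewrite ge0_integralZl_EFin //; last 2 first.
    - exact: measurable_seg.
    - by apply/measurable_EFinP; exact: measurable_indic.
    rewrite integral_indic //; last exact: measurable_seg.
    rewrite lamE // -EFinM EFinD; apply: leeD2l; rewrite (EFinM q (m x - t)).
    apply: lee_wpmul2l; first by rewrite lee_fin.
    apply: le_trans (upper_mass Ix tx).
    apply: le_measure; [rewrite inE|rewrite inE|by move=> y []] => //.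
    by apply: measurableI => //; exact: measurable_seg.
  (* The lower levels contribute a quarter by the choice of [K], the level of x another quarter
     because its mass is at most 1 / (4 k). *)
  have e1 : k * (p * m x) <= q / 4.
    rewrite /p; have -> : k * (q / K * m x) = q * (k * m x / K) by ring.
    apply: ler_wpM2l => //; rewrite ler_pdivrMr // /K.
    have := ler_wpM2l (ltW k0) (hm _ hx); lra.
  have e2 : k * (q * (m x - t)) <= q / 4.
    have -> : k * (q * (m x - t)) = q * (k * (m x - t)) by ring.
    apply: ler_wpM2l => //; have := ler_wpM2l (ltW k0) xt.
    have -> // : k * (4 * k)^-1 = 4^-1.
    by field; rewrite gt_eqF.
  have -> : C * K ^+ i x / 2 ^+ n.+1 = q / 2.
    by rewrite /q /c exprS; field; rewrite expf_neq0.
  rewrite mulrDr; lra.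
exists (C * K ^+ i x0); first by rewrite mulr_ge0 // exprn_ge0 // ltW.
move=> n x hx; apply: (le_trans (main _ _ hx)).
rewrite ler_wpM2r ?invr_ge0 ?exprn_ge0 // ler_wpM2l // ler_weXn2l //.
by apply: le_truncn; rewrite ler_pM2l ?hm // mulr_gt0.
Qed.

End Gronwall.

(** * Geometric convergence of real sequences *)

Section GeometricSequences.
Variable R : realType.

Lemma ltn_expr2 (n : nat) : n%:R < 2 ^+ n :> R.
Proof. by rewrite -natrX ltr_nat ltn_expl. Qed.

Lemma geometric_small (M e : R) : 0 < e -> exists N, forall n, (N <= n)%N -> M / 2 ^+ n <= e.
Proof.
move=> e0; exists (Num.truncn (M / e)).+1 => n Nn.
rewrite ler_pdivrMr ?exprn_gt0 // mulrC -ler_pdivrMr //.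
apply: (le_trans (ltW (truncnS_gt _))); apply: (@le_trans _ _ n%:R); first by rewrite ler_nat.
exact: ltW (ltn_expr2 n).
Qed.

Lemma le_geometric0 (r M : R) : (forall n, r <= M / 2 ^+ n) -> r <= 0.
Proof.
move=> rM; rewrite leNgt; apply/negP => r0.
have [N hN] := geometric_small M (divr_gt0 r0 (ltr0Sn _ 1)).
by have := hN _ (leqnn N); have := rM N; lra.
Qed.

(** The intervals [v n - e n, v n + e n] are nested, so the supremum of their left ends lies in all
    of them. *)
Lemma geometric_cvg (v : nat -> R) (M : R) : (forall n, `|v n.+1 - v n| <= M / 2 ^+ n) ->
  exists2 w, v @ \oo --> w & forall n, `|v n - w| <= 2 * M / 2 ^+ n.
Proof.
move=> vM; have M0 : 0 <= M by have := vM 0%N; rewrite expr0 divr1; apply: le_trans.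
(* The sum of the bounds M / 2 ^ k over k >= n, that is, of all the steps still to come. *)
pose e n : R := 2 * M / 2 ^+ n.
have eS n : e n = e n.+1 + M / 2 ^+ n.
  by rewrite /e exprS; field; rewrite expf_neq0.
have e0 n : 0 <= e n by rewrite /e divr_ge0 ?mulr_ge0 ?exprn_ge0.
have st n : - (M / 2 ^+ n) <= v n.+1 - v n <= M / 2 ^+ n by rewrite -ler_norml.
have lo n k : v n - e n <= v (n + k)%N - e (n + k)%N.
  elim: k => [|k ih]; first by rewrite addn0.
  rewrite addnS; have := st (n + k)%N; have := eS (n + k)%N; move: ih; lra.
have hi n k : v (n + k)%N + e (n + k)%N <= v n + e n.
  elim: k => [|k ih]; first by rewrite addn0.
  rewrite addnS; have := st (n + k)%N; have := eS (n + k)%N; move: ih; lra.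
have lohi n m : v n - e n <= v m + e m.
  have := lo n m; have := hi m n; rewrite addnC; have := e0 (n + m)%N; lra.
pose A := [set v n - e n | n in [set: nat]].
have A0 : A !=set0 by exists (v 0%N - e 0%N); exists 0%N.
have ubA n : ubound A (v n + e n) by move=> _ [k _ <-].
have bd n : `|v n - sup A| <= e n.
  have h1 : v n - e n <= sup A.
    by apply: ub_le_sup; [exists (v 0%N + e 0%N); exact: ubA|exists n].
  have h2 : sup A <= v n + e n by apply: ge_sup => //; exact: ubA.
  rewrite ler_norml; lra.
exists (sup A) => //; apply/cvgrPdist_le => d d0.
have [N hN] := geometric_small (2 * M) d0.
by exists N => // n /= Nn; rewrite distrC (le_trans (bd n)) // hN.
Qed.

End GeometricSequences.

(** * The Volterra system over open segments *)

Section Volterra.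
Variables (R : realType) (a b : \bar R) (l : bool).
Notation I := (oitv a b).
Notation seg := (seg a b l).
Notation cseg := (cseg a b l).

Definition regular (mu : cmeasure R) := polar_on I mu /\
  forall x, I x -> (cm_var mu (seg x) < +oo)%E.

(** Bounded up to the chosen endpoint, but possibly unbounded towards the other one. This is the
    class in which the system is solved. *)
Definition bounded_segs (h : R -> R[i]) := cmeasurable_on I h /\
  forall x, I x -> exists C, forall y, seg x y -> abs1 (h y) <= C.

Definition integrable_segs (mu : cmeasure R) (h : R -> R[i]) :=
  cmeasurable_on I h /\ forall x, I x -> cintegrable (cm_var mu) (seg x) h.

Let mI : measurable I. Proof. exact: measurable_oitv. Qed.
Let mseg x : measurable (seg x). Proof. exact: measurable_seg. Qed.
Let mcseg x : measurable (cseg x). Proof. exact: measurable_cseg. Qed.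

Lemma bounded_segsW mu h : regular mu -> bounded_segs h -> integrable_segs mu h.
Proof.
move=> rmu [mh bh]; split => // x Ix; have [C hC] := bh _ Ix.
apply: (cintegrable_bounded (mseg x) _ _ hC); first by apply rmu.
by apply: (cmeasurable_onS mI _ mh); exact: seg_sub.
Qed.

Lemma integrable_segsS mu h x D : integrable_segs mu h -> I x -> measurable D ->
  D `<=` seg x -> cintegrable (cm_var mu) D h.
Proof. by move=> [_ ih] Ix mD Dx; exact: cintegrableS (ih _ Ix). Qed.

(** A segment that may contain x sits inside the open segment of some point farther from the
    endpoint, so hypotheses on open segments suffice. *)
Lemma integrable_cseg mu h x : integrable_segs mu h -> I x ->
  cintegrable (cm_var mu) (cseg x) h.
Proof.
move=> ih Ix; have [y Iy yx] := seg_next l Ix.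
apply: (integrable_segsS ih Iy) => //; exact: cseg_sub_seg.
Qed.

Lemma integrable_segsD mu h h' : integrable_segs mu h -> integrable_segs mu h' ->
  integrable_segs mu (fun x => h x + h' x).
Proof.
move=> [m1 i1] [m2 i2]; split; first exact: cmeasurable_onD.
by move=> x Ix; apply: cintegrableD => //; [exact: i1|exact: i2].
Qed.

Lemma integrable_segsZ mu h w : integrable_segs mu h ->
  integrable_segs mu (fun x => w * h x).
Proof.
move=> [m1 i1]; split.
  by apply: cmeasurable_onM => //; exact: cmeasurable_on_cst.
by move=> x Ix; apply: cintegrableZ => //; exact: i1.
Qed.

Lemma polar_onSI D mu : regular mu -> D `<=` I -> polar_on D mu.
Proof. by move=> [pmu _] DI; exact: polar_onS pmu. Qed.

Lemma bounded_segs_cst w : bounded_segs (fun=> w).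
Proof. by split; [exact: cmeasurable_on_cst|move=> x _; exists (abs1 w)]. Qed.

Lemma bounded_segsD h h' : bounded_segs h -> bounded_segs h' -> bounded_segs (fun x => h x + h' x).
Proof.
move=> [m1 b1] [m2 b2]; split; first exact: cmeasurable_onD.
move=> x Ix; have [C1 h1] := b1 _ Ix; have [C2 h2] := b2 _ Ix.
exists (C1 + C2) => y xy; apply: (le_trans (abs1D _ _)).
by apply: lerD; [exact: h1|exact: h2].
Qed.

Lemma bounded_segsM h h' : bounded_segs h -> bounded_segs h' -> bounded_segs (fun x => h x * h' x).
Proof.
move=> [m1 b1] [m2 b2]; split; first exact: cmeasurable_onM.
move=> x Ix; have [C1 h1] := b1 _ Ix; have [C2 h2] := b2 _ Ix.
exists (C1 * C2) => y xy; apply: (le_trans (abs1M _ _)).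
by apply: ler_pM; rewrite ?abs1_ge0 //; [exact: h1|exact: h2].
Qed.

Lemma bounded_segsB h h' : bounded_segs h -> bounded_segs h' -> bounded_segs (fun x => h x - h' x).
Proof.
move=> n1 n2; have := bounded_segsD n1 (bounded_segsM (bounded_segs_cst (-1)) n2).
by under eq_fun do rewrite mulN1r.
Qed.

Lemma bounded_segs_cseg h x : bounded_segs h -> I x -> exists C, forall y, seg x y \/ y = x -> abs1 (h y) <= C.
Proof.
move=> [_ bh] Ix; have [y Iy yx] := seg_next l Ix; have [C hC] := bh _ Iy.
exists C => t [xt|->]; apply: hC => //; exact: (seg_sub_seg yx).
Qed.

Lemma bounded_segs_cint mu (D : R -> set R) h : regular mu -> integrable_segs mu h ->
  monotone_family I D -> (forall x, measurable (D x)) -> (forall x, D x `<=` cseg x) ->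
  bounded_segs (fun x => cint mu (D x) h).
Proof.
move=> rmu ih mon mD Dsub; split.
  apply: cmeasurable_cint => //; first exact: oitv_is_interval.
  move=> x Ix; split => //.
    by apply: polar_onSI => //; apply: (subset_trans (Dsub x)); exact: cseg_sub.
  exact: cintegrableS (integrable_cseg ih Ix).
move=> x Ix; have i := (proj2 ih) _ Ix.
have mh := cintegrable_measurable i.
have /(cintegrableP _ (mseg x) mh) ia := i.
exists (2 * fine (\int[cm_var mu]_(y in seg x) (abs1 (h y))%:E)) => y xy.
have Dx : D y `<=` seg x by apply: (subset_trans (Dsub y)); exact: cseg_sub_seg.
rewrite -lee_fin; apply: (le_trans (abs1_cint_le (mD y) _ _)).
- by apply: polar_onSI => //; apply: (subset_trans Dx); exact: seg_sub.
- exact: cintegrableS i.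
rewrite EFinM; apply: lee_wpmul2l => //.
rewrite fineK; last exact: (integrable_fin_num (mseg x) ia).
apply: ge0_subset_integral => //; last by move=> t _; rewrite lee_fin abs1_ge0.
by apply/measurable_EFinP; exact: measurable_abs1.
Qed.

Lemma bounded_segs_cint_seg mu h : regular mu -> integrable_segs mu h ->
  bounded_segs (fun x => cint mu (seg x) h).
Proof.
move=> rmu ih; apply: bounded_segs_cint => //; first exact: seg_monotone.
exact: seg_sub_cseg.
Qed.

Lemma bounded_segs_cint_cseg mu h : regular mu -> integrable_segs mu h ->
  bounded_segs (fun x => cint mu (cseg x) h).
Proof.
move=> rmu ih; apply: bounded_segs_cint => //; first exact: cseg_monotone.
by move=> x y.
Qed.

Variables (rho vs chi : cmeasure R) (z : R[i]) (g : R -> R[i]).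
Hypotheses (rrho : regular rho) (rvs : regular vs) (rchi : regular chi).
Hypothesis ig : integrable_segs rho g.

(** At the endpoint b, integrating from the endpoint to x gives minus the integral over [x,b). *)
Definition sgn : R[i] := if l then 1 else -1.

Lemma abs1_sgn w : abs1 (sgn * w) = abs1 w.
Proof. by rewrite /sgn; case: l; rewrite ?mul1r // mulN1r abs1N. Qed.

(** The Gronwall estimate handles one positive measure and one function. Their roles are played by
    the sum of the three variations and by [abs1 (f x) + abs1 (p x)]. *)
Definition total_var : {measure set R -> \bar R} :=
  measure_add (cm_var rho) (measure_add (cm_var vs) (cm_var chi)).

Lemma total_fin x : I x -> (total_var (seg x) < +oo)%E.
Proof.
move=> Ix.
have -> : total_var (seg x) = (cm_var rho (seg x) + (cm_var vs (seg x) + cm_var chi (seg x)))%E.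
  transitivity (measure_add (cm_var rho) (measure_add (cm_var vs) (cm_var chi)) (seg x)) => //.
  by rewrite measure_addE; congr (_ + _)%E; exact: measure_addE.
by rewrite !lte_add_pinfty //; [apply rrho|apply rvs|apply rchi].
Qed.

Lemma total_integral D (f : R -> R) : measurable D -> measurable_fun D f ->
  (forall x, 0 <= f x) ->
  [/\ (\int[cm_var rho]_(x in D) (f x)%:E <= \int[total_var]_(x in D) (f x)%:E)%E,
      (\int[cm_var vs]_(x in D) (f x)%:E <= \int[total_var]_(x in D) (f x)%:E)%E &
      (\int[cm_var chi]_(x in D) (f x)%:E <= \int[total_var]_(x in D) (f x)%:E)%E].
Proof.
move=> mD mf f0; rewrite /total_var.
have f0' x : D x -> (0 <= (f x)%:E)%E by rewrite lee_fin.
have mf' : measurable_fun D (fun x => (f x)%:E) by exact/measurable_EFinP.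
rewrite !ge0_integral_measure_add //.
have i1 := integral_ge0 (cm_var rho) f0'; have i2 := integral_ge0 (cm_var vs) f0'.
have i3 := integral_ge0 (cm_var chi) f0'.
split; first by rewrite leeDl // adde_ge0.
  by rewrite addeCA leeDl // adde_ge0.
by rewrite addeA leeDr // adde_ge0.
Qed.

(** Each of the integrals against [vs], [chi] and [rho] costs the factor 2 of [abs1_cint_le], the
    last one multiplied by [abs1 z]: this is 2 + 2 + 2 * abs1 z. *)
Lemma lin_bound D f p : measurable D -> D `<=` I ->
  cintegrable (cm_var vs) D p -> cintegrable (cm_var chi) D f ->
  cintegrable (cm_var rho) D f ->
  ((abs1 (cint vs D p) + abs1 (cint chi D f - z * cint rho D f))%:E <=
   (4 + 2 * abs1 z)%:E * \int[total_var]_(x in D) (abs1 (f x) + abs1 (p x))%:E)%E.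
Proof.
move=> mD DI ip if1 if2.
have mf := measurable_abs1 (cintegrable_measurable if1).
have mp := measurable_abs1 (cintegrable_measurable ip).
have mfp : measurable_fun D (fun x => abs1 (f x) + abs1 (p x)) by exact: measurable_funD.
pose J := (\int[total_var]_(x in D) (abs1 (f x) + abs1 (p x))%:E)%E.
have fp0 x : 0 <= abs1 (f x) + abs1 (p x) by rewrite addr_ge0 ?abs1_ge0.
have [t1 t2 t3] := total_integral mD mfp fp0.
have J0 : (0 <= J)%E by apply: integral_ge0 => x _; rewrite lee_fin.
have est mu h : regular mu -> cintegrable (cm_var mu) D h ->
   (forall x, abs1 (h x) <= abs1 (f x) + abs1 (p x)) ->
   (\int[cm_var mu]_(x in D) (abs1 (f x) + abs1 (p x))%:E <= J)%E ->
   ((abs1 (cint mu D h))%:E <= 2%:E * J)%E.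
  move=> rmu ih hfp le; apply: (le_trans (abs1_cint_le mD (polar_onSI rmu DI) ih)).
  apply: lee_wpmul2l => //; apply: le_trans le; apply: ge0_le_integral => //.
  - by move=> x _; rewrite lee_fin abs1_ge0.
  - apply/measurable_EFinP; exact: measurable_abs1 (cintegrable_measurable ih).
  - exact/measurable_EFinP.
  - by move=> x _; rewrite lee_fin.
have ep : forall x, abs1 (p x) <= abs1 (f x) + abs1 (p x) by move=> x; rewrite lerDr abs1_ge0.
have ef : forall x, abs1 (f x) <= abs1 (f x) + abs1 (p x) by move=> x; rewrite lerDl abs1_ge0.
have e1 := est _ _ rvs ip ep t2; have e2 := est _ _ rchi if1 ef t3.
have e3 := est _ _ rrho if2 ef t1.
apply: (@le_trans _ _ (2%:E * J + (2%:E * J + (abs1 z)%:E * (2%:E * J)))%E).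
  rewrite EFinD; apply: leeD => //.
  apply: (@le_trans _ _ (abs1 (cint chi D f) + abs1 z * abs1 (cint rho D f))%:E).
    by rewrite lee_fin (le_trans (abs1B _ _)) // lerD2l abs1M.
  rewrite EFinD EFinM; apply: leeD => //; apply: lee_wpmul2l => //.
  by rewrite lee_fin abs1_ge0.
rewrite muleA -!ge0_muleDl ?adde_ge0 ?mule_ge0 ?lee_fin ?abs1_ge0 //.
apply: lee_wpmul2r => //; rewrite -EFinM -!EFinD lee_fin; lra.
Qed.

Lemma measurable_pair f p : bounded_segs f -> bounded_segs p ->
  measurable_fun I (fun x => abs1 (f x) + abs1 (p x)).
Proof. by move=> [mf _] [mp _]; apply: measurable_funD; exact: measurable_abs1. Qed.

Lemma lin_bound_seg f p x : bounded_segs f -> bounded_segs p -> I x ->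
  ((abs1 (cint vs (seg x) p) + abs1 (cint chi (seg x) f - z * cint rho (seg x) f))%:E <=
   (4 + 2 * abs1 z)%:E * \int[total_var]_(y in seg x) (abs1 (f y) + abs1 (p y))%:E)%E.
Proof.
move=> nf np Ix; apply: lin_bound => //; first exact: seg_sub.
- by apply (bounded_segsW rvs np).
- by apply (bounded_segsW rchi nf).
- by apply (bounded_segsW rrho nf).
Qed.

Lemma k_gt0 : 0 < 4 + 2 * abs1 z.
Proof. by have := abs1_ge0 z; lra. Qed.

(** The Gronwall estimate, applied to the constant sequence [abs1 (f y) + abs1 (p y)], bounds it by
    M / 2 ^ n for every n. *)
Lemma volterra_unique0 f p : bounded_segs f -> bounded_segs p ->
  (forall x, I x -> f x = sgn * cint vs (seg x) p) ->
  (forall x, I x -> p x = sgn * (cint chi (seg x) f - z * cint rho (seg x) f)) ->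
  forall x, I x -> f x = 0 /\ p x = 0.
Proof.
move=> nf np ef ep x Ix.
have [C1 h1] := bounded_segs_cseg nf Ix; have [C2 h2] := bounded_segs_cseg np Ix.
have [||||||M M0 hM] := @gronwall R a b l total_var total_fin (4 + 2 * abs1 z) (C1 + C2) x
  (fun _ y => abs1 (f y) + abs1 (p y)).
- exact: k_gt0.
- by [].
- by move=> _; exact: measurable_pair.
- by move=> _ y; rewrite addr_ge0 ?abs1_ge0.
- by move=> y hy; apply: lerD; [exact: h1|exact: h2].
- move=> _ y hy; have Iy : I y by case: hy => [/seg_sub|->].
  by rewrite {1}ef // {1}ep // !abs1_sgn; exact: lin_bound_seg.
have : abs1 (f x) + abs1 (p x) <= 0.
  by apply: (@le_geometric0 _ _ M) => n; apply: hM; right.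
have := abs1_ge0 (f x); have := abs1_ge0 (p x) => p0 f0 fp.
by split; apply: abs1_eq0; lra.
Qed.

Section existence.
Variables d1 d2 : R[i].

Let T1 (p : R -> R[i]) x := d1 + sgn * cint vs (seg x) p.
Let T2 (f : R -> R[i]) x := d2 + sgn * (cint chi (seg x) f -
  (z * cint rho (seg x) f + cint rho (seg x) g)).
(** The successive approximations of the pair (f, p), started at zero. *)
Let w n := iter n (fun fp : (R -> R[i]) * (R -> R[i]) => (T1 fp.2, T2 fp.1)) (fun=> 0, fun=> 0).

Let bounded_segs_w n : bounded_segs (w n).1 /\ bounded_segs (w n).2.
Proof.
elim: n => [|n [n1 n2]] /=; first by split; exact: bounded_segs_cst.
split.
  apply: bounded_segsD; first exact: bounded_segs_cst.
  apply: bounded_segsM; first exact: bounded_segs_cst.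
  by apply: bounded_segs_cint_seg => //; exact: bounded_segsW.
apply: bounded_segsD; first exact: bounded_segs_cst.
apply: bounded_segsM; first exact: bounded_segs_cst.
apply: bounded_segsB.
  by apply: bounded_segs_cint_seg => //; exact: bounded_segsW.
apply: bounded_segsD; last exact: bounded_segs_cint_seg.
apply: bounded_segsM; first exact: bounded_segs_cst.
by apply: bounded_segs_cint_seg => //; exact: bounded_segsW.
Qed.

(** In the differences of consecutive approximations [d1], [d2] and [g] cancel, so these obey the
    homogeneous recursion to which the Gronwall estimate applies. *)
Let df n x := (w n.+1).1 x - (w n).1 x.
Let dp n x := (w n.+1).2 x - (w n).2 x.

Let bounded_segs_df n : bounded_segs (df n).
Proof. by apply: bounded_segsB; [case: (bounded_segs_w n.+1)|case: (bounded_segs_w n)]. Qed.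
Let bounded_segs_dp n : bounded_segs (dp n).
Proof. by apply: bounded_segsB; [case: (bounded_segs_w n.+1)|case: (bounded_segs_w n)]. Qed.

Let cintB_nice mu h h' x : regular mu -> bounded_segs h -> bounded_segs h' -> I x ->
  cint mu (seg x) (fun y => h y - h' y) = cint mu (seg x) h - cint mu (seg x) h'.
Proof.
move=> rmu nh nh' Ix; apply: cintB => //.
- apply: polar_onSI => //; exact: seg_sub.
- by apply (bounded_segsW rmu nh).
- by apply (bounded_segsW rmu nh').
Qed.

Let dfS n x : I x -> df n.+1 x = sgn * cint vs (seg x) (dp n).
Proof.
move=> Ix; have [_ n1] := bounded_segs_w n; have [_ n2] := bounded_segs_w n.+1.
rewrite /dp cintB_nice // /df.
by rewrite [(w n.+2).1 x]/= [in X in _ - X](_ : (w n.+1).1 x = T1 (w n).2 x) // /T1; ring.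
Qed.

Let dpS n x : I x ->
  dp n.+1 x = sgn * (cint chi (seg x) (df n) - z * cint rho (seg x) (df n)).
Proof.
move=> Ix; have [n1 _] := bounded_segs_w n; have [n2 _] := bounded_segs_w n.+1.
rewrite /df !cintB_nice // /dp.
by rewrite [(w n.+2).2 x]/= [in X in _ - X](_ : (w n.+1).2 x = T2 (w n).1 x) // /T2; ring.
Qed.

Let geometric x0 : I x0 -> exists2 M, 0 <= M &
  forall n x, seg x0 x \/ x = x0 -> abs1 (df n x) + abs1 (dp n x) <= M / 2 ^+ n.
Proof.
move=> Ix0.
have [C1 h1] := bounded_segs_cseg (bounded_segs_df 0) Ix0.
have [C2 h2] := bounded_segs_cseg (bounded_segs_dp 0) Ix0.
apply: (@gronwall R a b l total_var total_fin (4 + 2 * abs1 z) (C1 + C2) x0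
  (fun n y => abs1 (df n y) + abs1 (dp n y))).
- exact: k_gt0.
- by [].
- by move=> n; exact: measurable_pair.
- by move=> n y; rewrite addr_ge0 ?abs1_ge0.
- by move=> y hy; apply: lerD; [exact: h1|exact: h2].
- move=> n y hy; have Iy : I y by case: hy => [/seg_sub|->].
  by rewrite dfS // dpS // !abs1_sgn; exact: lin_bound_seg.
Qed.

(** Limits are taken componentwise, so that convergence and measurability reduce to real
    sequences. *)
Let climit (v : nat -> R -> R[i]) x : R[i] :=
  Complex (lim ((fun n => complex.Re (v n x)) @ \oo)) (lim ((fun n => complex.Im (v n x)) @ \oo)).

(** Each component is within 2 M / 2 ^ n of its limit; [abs1] adds the two. *)
Let climit_bound (v : nat -> R -> R[i]) x M :
  (forall n, abs1 (v n.+1 x - v n x) <= M / 2 ^+ n) ->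
  [/\ (fun n => complex.Re (v n x)) @ \oo --> complex.Re (climit v x),
      (fun n => complex.Im (v n x)) @ \oo --> complex.Im (climit v x) &
      forall n, abs1 (v n x - climit v x) <= 4 * M / 2 ^+ n].
Proof.
move=> vM.
have [n|r1 c1 b1] := @geometric_cvg _ (fun n => complex.Re (v n x)) M.
  by have := vM n; rewrite /abs1 ReD ReN; apply: le_trans; rewrite lerDl.
have [n|r2 c2 b2] := @geometric_cvg _ (fun n => complex.Im (v n x)) M.
  by have := vM n; rewrite /abs1 ImD ImN; apply: le_trans; rewrite lerDr.
rewrite /climit (cvg_lim _ c1) // (cvg_lim _ c2) //; split => // n.
rewrite /abs1 ReD ReN ImD ImN /=; have := b1 n; have := b2 n; lra.
Qed.

Let bounded_segs_climit (v : nat -> R -> R[i]) : (forall n, bounded_segs (v n)) ->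
  (forall x0, I x0 -> exists M, forall n x, seg x0 x \/ x = x0 ->
     abs1 (v n.+1 x - v n x) <= M / 2 ^+ n) -> bounded_segs (climit v).
Proof.
move=> nv hv; split; [split|].
- apply: (@measurable_fun_cvg _ _ _ _ (fun n x => complex.Re (v n x))).
    by move=> n; case: (nv n) => -[].
  move=> x Ix; have [M hM] := hv _ Ix.
  by have [] := @climit_bound v x M (fun n => hM n x (or_intror erefl)).
- apply: (@measurable_fun_cvg _ _ _ _ (fun n x => complex.Im (v n x))).
    by move=> n; case: (nv n) => -[].
  move=> x Ix; have [M hM] := hv _ Ix.
  by have [] := @climit_bound v x M (fun n => hM n x (or_intror erefl)).
move=> x Ix; have [M hM] := hv _ Ix; have [C hC] := (proj2 (nv 0%N)) _ Ix.
exists (C + 4 * M) => y xy.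
have [_ _ /(_ 0%N)] := @climit_bound v y M (fun n => hM n y (or_introl xy)).
rewrite expr0 divr1 => h.
have -> : climit v y = v 0%N y - (v 0%N y - climit v y) by ring.
by apply: (le_trans (abs1B _ _)); apply: lerD => //; exact: hC.
Qed.

Lemma volterra_exists : exists f p, [/\ bounded_segs f, bounded_segs p,
  (forall x, I x -> f x = d1 + sgn * cint vs (seg x) p) &
  (forall x, I x -> p x = d2 + sgn * (cint chi (seg x) f -
      (z * cint rho (seg x) f + cint rho (seg x) g)))].
Proof.
pose F n := (w n).1; pose P n := (w n).2.
have gF x0 : I x0 -> exists M, forall n x, seg x0 x \/ x = x0 ->
    abs1 (F n.+1 x - F n x) <= M / 2 ^+ n.
  move=> Ix0; have [M _ hM] := geometric Ix0; exists M => n x hx.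
  by apply: le_trans (hM n x hx); rewrite lerDl abs1_ge0.
have gP x0 : I x0 -> exists M, forall n x, seg x0 x \/ x = x0 ->
    abs1 (P n.+1 x - P n x) <= M / 2 ^+ n.
  move=> Ix0; have [M _ hM] := geometric Ix0; exists M => n x hx.
  by apply: le_trans (hM n x hx); rewrite lerDr abs1_ge0.
have nF n : bounded_segs (F n) by case: (bounded_segs_w n).
have nP n : bounded_segs (P n) by case: (bounded_segs_w n).
have nf := bounded_segs_climit nF gF; have np := bounded_segs_climit nP gP.
set f := climit F in nf; set p := climit P in np.
(* Allows passing to the limit under the integral sign: the approximations converge uniformly on
   [seg x], which has finite mass. One constant serves both the values at x and the integrals. *)
have cv mu (v : nat -> R -> R[i]) : (forall n, bounded_segs (v n)) ->
   (forall x0, I x0 -> exists M, forall n x, seg x0 x \/ x = x0 ->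
     abs1 (v n.+1 x - v n x) <= M / 2 ^+ n) -> bounded_segs (climit v) -> regular mu ->
   forall x, I x -> exists M, forall n,
     abs1 (v n.+1 x - climit v x) <= M / 2 ^+ n /\
     abs1 (cint mu (seg x) (v n) - cint mu (seg x) (climit v)) <= M / 2 ^+ n.
  move=> nv hv ncv rmu x Ix; have [M hM] := hv _ Ix.
  have bd n y : seg x y \/ y = x -> abs1 (v n y - climit v y) <= 4 * M / 2 ^+ n.
    by move=> hy; have [] := @climit_bound v y M (fun n => hM n y hy).
  have M0 : 0 <= M.
    by have := hM 0%N x (or_intror erefl); rewrite expr0 divr1; apply: le_trans; exact: abs1_ge0.
  have V0 : 0 <= fine (cm_var mu (seg x)) by exact: fine_ge0.
  exists (4 * M + 2 * (4 * M) * fine (cm_var mu (seg x))) => n.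
  have i0 : 0 <= (2 ^+ n)^-1 :> R by rewrite invr_ge0 exprn_ge0.
  split.
    apply: (le_trans (bd n.+1 x (or_intror erefl))).
    rewrite exprS invfM.
    have := mulr_ge0 M0 i0; have := mulr_ge0 (mulr_ge0 M0 i0) V0; lra.
  rewrite -cintB_nice //.
  apply: (le_trans (abs1_cint_bounded (mseg x) _ _ _ (C := 4 * M / 2 ^+ n) _)).
  - apply: polar_onSI => //; exact: seg_sub.
  - by apply rmu.
  - apply: (cmeasurable_onS mI (@seg_sub _ a b l x)).
    by case: (bounded_segsB (nv n) ncv).
  - by move=> y xy; apply: bd; left.
  have := mulr_ge0 M0 i0; lra.
exists f, p; split => // x Ix.
  have [M1 h1] := cv vs P nP gP np rvs x Ix; have [M2 h2] := cv vs F nF gF nf rvs x Ix.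
  apply/eqP; rewrite -subr_eq0; apply/eqP/abs1_eq0.
  apply: (@le_geometric0 _ _ (M1 + M2)) => n.
  (* The iterates satisfy F n.+1 = T1 (P n) exactly, so the defect of the limit is a sum of two
     errors, each geometrically small in n. *)
  have -> : f x - (d1 + sgn * cint vs (seg x) p) =
    sgn * (cint vs (seg x) (P n) - cint vs (seg x) p) - (F n.+1 x - f x).
    by rewrite /F /= /T1 -/(P n); ring.
  apply: (le_trans (abs1B _ _)); rewrite abs1_sgn mulrDl; apply: lerD.
    by case: (h1 n).
  by case: (h2 n).
have [M1 h1] := cv chi F nF gF nf rchi x Ix; have [M2 h2] := cv rho F nF gF nf rrho x Ix.
have [M3 h3] := cv vs P nP gP np rvs x Ix.
apply/eqP; rewrite -subr_eq0; apply/eqP/abs1_eq0.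
apply: (@le_geometric0 _ _ (M1 + abs1 z * M2 + M3)) => n.
have -> : p x - (d2 + sgn * (cint chi (seg x) f -
      (z * cint rho (seg x) f + cint rho (seg x) g))) =
    sgn * ((cint chi (seg x) (F n) - cint chi (seg x) f) -
      z * (cint rho (seg x) (F n) - cint rho (seg x) f)) - (P n.+1 x - p x).
  by rewrite /P /= /T2 -/(F n); ring.
apply: (le_trans (abs1B _ _)); rewrite abs1_sgn (mulrDl (M1 + _)) (mulrDl M1);
  apply: lerD; last by case: (h3 n).
apply: (le_trans (abs1B _ _)); apply: lerD; first by case: (h1 n).
apply: (le_trans (abs1M _ _)); rewrite -(mulrA (abs1 z)); apply: ler_wpM2l; first exact: abs1_ge0.
by case: (h2 n).
Qed.

End existence.

End Volterra.

(** * Atoms, null sets and smallness of integrals near the endpoint *)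

Section Atoms.
Variables (R : realType) (a b : \bar R) (l : bool).
Notation I := (oitv a b).
Notation seg := (seg a b l).
Notation cseg := (cseg a b l).
Notation regular := (regular a b l).
Notation integrable_segs := (integrable_segs a b l).
Notation bounded_segs := (bounded_segs a b l).
Notation sgn := (sgn R l).

Let mI : measurable I. Proof. exact: measurable_oitv. Qed.
Let mseg x : measurable (seg x). Proof. exact: measurable_seg. Qed.
Let mcseg x : measurable (cseg x). Proof. exact: measurable_cseg. Qed.

(** An atom at x makes the mass jump from m x to m x + mu {x}. For distinct atoms these open gaps
    are disjoint, so a rational chosen in each gives an injection. *)
Lemma countable_atoms mu : regular mu ->
  countable [set x | I x /\ cm_var mu [set x] <> 0%E].
Proof.
move=> [_ fmu]; pose m x := fine (cm_var mu (seg x)).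
have mE x : I x -> cm_var mu (seg x) = (m x)%:E.
  by move=> Ix; rewrite /m fineK // ge0_fin_numE // fmu.
have f1 x : I x -> exists2 r, cm_var mu [set x] = r%:E & 0 <= r.
  move=> Ix; have [y Iy yx] := seg_next l Ix.
  have h : (cm_var mu [set x] < +oo)%E.
    apply: (le_lt_trans _ (fmu _ Iy)); by apply: le_measure; rewrite ?inE // => _ ->.
  exists (fine (cm_var mu [set x])); last exact: fine_ge0.
  by rewrite fineK // ge0_fin_numE.
pose A := [set x | I x /\ cm_var mu [set x] <> 0%E].
have pick x : exists q : rat, A x ->
    (m x < ratr q)%R /\ ((ratr q)%:E < cm_var mu (seg x) + cm_var mu [set x])%E.
  have [[Ix nx]|nA] := pselect (A x); last by exists 0.
  have [r er r0] := f1 _ Ix; rewrite er in nx.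
  have rp : 0 < r by rewrite lt_neqAle r0 andbT; apply/eqP => h; apply: nx; rewrite -h.
  have [q] := @rat_in_itvoo R (m x) (m x + r) (ltac:(lra)).
  rewrite in_itv /= => /andP[h1 h2]; exists q => _; split => //.
  by rewrite mE // er -EFinD lte_fin.
pose q x := projT1 (cid (pick x)).
have hq x : A x -> m x < ratr (q x) /\ ((ratr (q x))%:E < cm_var mu (seg x) + cm_var mu [set x])%E.
  by rewrite /q; case: (cid (pick x)).
apply/countable_injP; exists (fun x => pickle (q x)).
have lt x y : A x -> A y -> seg y x -> ratr (q x) < (ratr (q y) : R).
  move=> Ax Ay yx; have [_ h1] := hq _ Ax; have [h2 _] := hq _ Ay.
  rewrite -lte_fin; apply: (lt_trans h1); apply: (@le_lt_trans _ _ (m y)%:E); last by rewrite lte_fin.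
  rewrite -mE; last by case: Ay.
  rewrite -measureU //; last first.
    by apply/seteqP; split => // t [] /[swap] /= -> /seg_irr.
  apply: le_measure; rewrite ?inE //; first by apply: measurableU => //; exact: measurable_set1.
  by move=> t [|/= ->//]; exact: seg_sub_seg.
move=> x y; rewrite !inE => Ax Ay /(pcan_inj pickleK) qxy.
have [s|s|//] := seg_cmp l (proj1 Ax) (proj1 Ay).
  by have := lt _ _ Ay Ax s; rewrite qxy ltxx.
by have := lt _ _ Ax Ay s; rewrite qxy ltxx.
Qed.

Lemma countable_negligible (lam : {measure set R -> \bar R}) (A : set R) :
  countable A -> (forall x, A x -> lam [set x] = 0%E) -> lam.-negligible A.
Proof.
move=> /countable_injP[f injf] A0.
apply: (@negligibleS _ _ _ _ (\bigcup_n [set x | A x /\ f x = n])).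
  by move=> x Ax; exists (f x).
apply: negligible_bigcup => n.
have [->|/set0P[x [Ax fx]]] := eqVneq [set x | A x /\ f x = n] set0; first exact: negligible_set0.
apply: (@negligibleS _ _ _ _ [set x]).
  by move=> y [Ay fy] /=; apply: injf; rewrite ?inE // fx fy.
apply/negligibleP; [exact: measurable_set1|exact: A0].
Qed.

(** The atoms of [mu] are countably many points, each null for [nu]. *)
Lemma ae_no_atom mu nu : regular mu ->
  (forall x, I x -> cm_var mu [set x] = 0%E \/ cm_var nu [set x] = 0%E) ->
  {ae cm_var nu, forall x, I x -> cm_var mu [set x] = 0%E}.
Proof.
move=> rmu at0; apply: (@negligibleS _ _ _ _ [set x | I x /\ cm_var mu [set x] <> 0%E]).
  by move=> x /= /not_implyP.
apply: countable_negligible; first exact: countable_atoms.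
by move=> x [Ix nx]; case: (at0 x Ix).
Qed.

(** Empty at the endpoint a and the singleton {x} at b: exactly what distinguishes [cseg x] from
    [seg x]. *)
Let atom x := cseg x `&` [set x].

Let matom x : measurable (atom x).
Proof. by apply: measurableI => //; exact: measurable_set1. Qed.

Lemma cint_cseg mu h x : regular mu -> integrable_segs mu h -> I x ->
  cint mu (cseg x) h = cint mu (seg x) h + cint mu (atom x) h.
Proof.
move=> rmu ih Ix.
have e : cseg x = seg x `|` atom x.
  apply/seteqP; split => t.
    by move=> ct; have [st|tx] := csegW ct; [left|right].
  by move=> [|[]//]; exact: seg_sub_cseg.
rewrite {1}e cintU //.
- by rewrite -e; apply: (polar_onSI rmu); exact: cseg_sub.
- by rewrite -e; exact: integrable_cseg.
- by apply/seteqP; split => // t [] /[swap] -[_ /= ->] /seg_irr.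
Qed.

Lemma cint_atom_null mu h x : regular mu -> integrable_segs mu h -> I x ->
  cm_var mu [set x] = 0%E -> cint mu (atom x) h = 0.
Proof.
move=> rmu ih Ix m0; apply: cint_null => //.
- by apply: (polar_onSI rmu) => t [/cseg_sub].
- by apply: (cmeasurable_onS mI _ (proj1 ih)) => t [/cseg_sub].
- by apply/eqP; rewrite -measure_le0 -m0; apply: le_measure; rewrite ?inE // => t [].
Qed.

Lemma cint_atom0 mu h x : h x = 0 -> cint mu (atom x) h = 0.
Proof.
move=> hx; rewrite (@eq_cint _ _ _ _ (fun=> 0)); last by move=> t [_ ->].
rewrite /cint /cint_pos; apply: complex_ext => /=;
  under eq_Rintegral do rewrite mul0r; by rewrite Rintegral_cst // mul0r.
Qed.

(** Absolute continuity of the integral, combined with segments of arbitrarily small mass near the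
    endpoint. This is what produces the limits at the endpoint. *)
Lemma cint_small mu h (e : R) : regular mu -> integrable_segs mu h -> (exists x, I x) -> 0 < e ->
  exists2 x, I x & forall y, seg x y -> abs1 (cint mu (cseg y) h) < e.
Proof.
move=> rmu ih [c Ic] e0.
have i := (proj2 ih) _ Ic; have mh := cintegrable_measurable i.
have /(cintegrableP _ (mseg c) mh) ia := i.
(* Extended by zero, the integrand is integrable on the whole line, as the absolute continuity
   result requires; e / 2 below absorbs the factor 2 of [abs1_cint_le]. *)
pose f := (fun x => abs1 (h x)) \_ (seg c).
have intf : (cm_var mu).-integrable setT (EFin \o f).
  have -> : EFin \o f = (fun x => (abs1 (h x))%:E) \_ (seg c).
    by rewrite /f restrict_EFin.
  by apply/(integrable_mkcond _ (mseg c)).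
have [|d [d0 hd]] := integral_normr_continuous intf (e := e / 2); first lra.
have [x cx xd] := seg_small (l := l) Ic d0 (proj2 rmu _ Ic).
exists x; first exact: seg_sub cx.
move=> y xy; have yc : cseg y `<=` seg c.
  by apply: (subset_trans (cseg_sub_seg xy)); exact: seg_sub_seg.
have mud : (cm_var mu (cseg y) < d%:E)%E.
  apply: le_lt_trans xd; apply: le_measure; rewrite ?inE //; exact: cseg_sub_seg.
have ihy := integrable_segsS ih Ic (mcseg y) yc.
have pol : polar_on (cseg y) mu by apply: (polar_onSI rmu); exact: cseg_sub.
rewrite -lte_fin; apply: (le_lt_trans (abs1_cint_le (mcseg y) pol ihy)).
have := hd _ (mcseg y) mud; rewrite /Rintegral.
have -> : (\int[cm_var mu]_(x0 in cseg y) (`|f x0|)%:E =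
   \int[cm_var mu]_(x0 in cseg y) (abs1 (h x0))%:E)%E.
  apply: eq_integral => t; rewrite inE => ct; rewrite /f patchE mem_set ?ger0_norm ?abs1_ge0 //.
  exact: yc.
have /(cintegrableP _ (mcseg y) (cintegrable_measurable ihy)) iay := ihy.
have fn := integrable_fin_num (mcseg y) iay.
move=> he; rewrite -[X in (_ * X)%E](fineK fn) -EFinM lte_fin; lra.
Qed.

End Atoms.

(** * The integral system over half-open segments: solvability, limits, reality *)

Section IntegralSystem.
Variables (R : realType) (a b : \bar R) (l : bool).
Notation I := (oitv a b).
Notation seg := (seg a b l).
Notation cseg := (cseg a b l).
Notation regular := (regular a b l).
Notation integrable_segs := (integrable_segs a b l).
Notation bounded_segs := (bounded_segs a b l).
Notation sgn := (sgn R l).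

Variables (rho vs chi : cmeasure R) (z : R[i]) (g : R -> R[i]).
Hypotheses (rrho : regular rho) (rvs : regular vs) (rchi : regular chi).
Hypothesis ig : integrable_segs rho g.
Hypothesis atoms : forall x, I x -> cm_var vs [set x] = 0%E \/
  (cm_var rho [set x] = 0%E /\ cm_var chi [set x] = 0%E).

Let mI : measurable I. Proof. exact: measurable_oitv. Qed.
Let mcseg x : measurable (cseg x). Proof. exact: measurable_cseg. Qed.
Let mseg x : measurable (seg x). Proof. exact: measurable_seg. Qed.

(** The form of the problem that matches D_tau at every point, with [p] the quasi-derivative and
    [d1], [d2] the values at the endpoint. *)
Definition integral_system f p d1 d2 := [/\ bounded_segs f, bounded_segs p,
  (forall x, I x -> f x = d1 + sgn * cint vs (cseg x) p) &
  (forall x, I x -> p x = d2 + sgn * (cint chi (cseg x) f -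
      (z * cint rho (cseg x) f + cint rho (cseg x) g)))].

Definition lim_end (f : R -> R[i]) (d : R[i]) := forall e : R, 0 < e ->
  exists al, I al /\ forall x, seg al x -> Normc.normc (f x - d) < e.

(** The atoms of [rho] and [chi] are null for [vs], so a property that can fail only there holds
    almost everywhere. The next two facts exchange the roles. *)
Let ae_vs (P : R -> Prop) : (forall x, I x -> cm_var rho [set x] = 0%E ->
    cm_var chi [set x] = 0%E -> P x) -> {ae cm_var vs, forall x, I x -> P x}.
Proof.
move=> h; have a1 : {ae cm_var vs, forall x, I x -> cm_var rho [set x] = 0%E}.
  by apply: (ae_no_atom rrho) => x Ix; have [?|[? ?]] := atoms Ix; [right|left].
have a2 : {ae cm_var vs, forall x, I x -> cm_var chi [set x] = 0%E}.
  by apply: (ae_no_atom rchi) => x Ix; have [?|[? ?]] := atoms Ix; [right|left].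
by apply: filterS2 a1 a2 => x h1 h2 Ix; apply: h => //; [exact: h1|exact: h2].
Qed.

Let ae_rho (P : R -> Prop) : (forall x, I x -> cm_var vs [set x] = 0%E -> P x) ->
  {ae cm_var rho, forall x, I x -> P x}.
Proof.
move=> h; have a1 : {ae cm_var rho, forall x, I x -> cm_var vs [set x] = 0%E}.
  by apply: (ae_no_atom rvs) => x Ix; have [?|[? ?]] := atoms Ix; [left|right].
by apply: filterS a1 => x h1 Ix; apply: h => //; exact: h1.
Qed.

Let ae_chi (P : R -> Prop) : (forall x, I x -> cm_var vs [set x] = 0%E -> P x) ->
  {ae cm_var chi, forall x, I x -> P x}.
Proof.
move=> h; have a1 : {ae cm_var chi, forall x, I x -> cm_var vs [set x] = 0%E}.
  by apply: (ae_no_atom rvs) => x Ix; have [?|[? ?]] := atoms Ix; [left|right].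
by apply: filterS a1 => x h1 Ix; apply: h => //; exact: h1.
Qed.

Let cint_ae mu D h h' : regular mu -> measurable D -> D `<=` I -> bounded_segs h -> bounded_segs h' ->
  {ae cm_var mu, forall x, I x -> h x = h' x} -> cint mu D h = cint mu D h'.
Proof.
move=> rmu mD DI [mh _] [mh' _] e; apply: ae_eq_cint => //.
- exact: polar_onSI rmu _.
- exact: cmeasurable_onS mh.
- exact: cmeasurable_onS mh'.
- by apply: filterS e => x e /DI /e.
Qed.

Lemma cint_cseg_eq mu h x : regular mu -> integrable_segs mu h -> I x ->
  cm_var mu [set x] = 0%E -> cint mu (cseg x) h = cint mu (seg x) h.
Proof. by move=> rmu ih Ix m0; rewrite (cint_cseg rmu ih Ix) cint_atom_null ?addr0. Qed.

(* Passing from closed to open segments changes f only at atoms of vs and p only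
   at atoms of chi and rho, hence does not affect the integrals. *)
Lemma integral_system_exists d1 d2 : exists f p, integral_system f p d1 d2.
Proof.
have [f [p [nf np ef ep]]] := volterra_exists z rrho rvs rchi ig d1 d2.
have ipv := bounded_segsW rvs np; have ifc := bounded_segsW rchi nf; have ifr := bounded_segsW rrho nf.
pose f' x := d1 + sgn * cint vs (cseg x) p.
pose p' x := d2 + sgn * (cint chi (cseg x) f - (z * cint rho (cseg x) f + cint rho (cseg x) g)).
have nf' : bounded_segs f'.
  apply: bounded_segsD; first exact: bounded_segs_cst.
  apply: bounded_segsM; first exact: bounded_segs_cst.
  exact: bounded_segs_cint_cseg.
have np' : bounded_segs p'.
  apply: bounded_segsD; first exact: bounded_segs_cst.
  apply: bounded_segsM; first exact: bounded_segs_cst.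
  apply: bounded_segsB; first exact: bounded_segs_cint_cseg.
  apply: bounded_segsD; last exact: bounded_segs_cint_cseg.
  apply: bounded_segsM; first exact: bounded_segs_cst.
  exact: bounded_segs_cint_cseg.
have ff x : I x -> cm_var vs [set x] = 0%E -> f' x = f x.
  by move=> Ix v0; rewrite /f' cint_cseg_eq // ef.
have pp x : I x -> cm_var rho [set x] = 0%E -> cm_var chi [set x] = 0%E -> p' x = p x.
  by move=> Ix r0 c0; rewrite /p' !cint_cseg_eq // ep.
exists f', p'; split => // x Ix; have DI := @cseg_sub _ a b l x.
  by rewrite (cint_ae rvs (mcseg x) DI np' np (ae_vs pp)).
by rewrite (cint_ae rchi (mcseg x) DI nf' nf (ae_chi ff)) (cint_ae rrho (mcseg x) DI nf' nf (ae_rho ff)).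
Qed.

(** The difference (F, P) of two solutions solves the homogeneous half-open system. Its open-segment
    counterpart (phi, psi) agrees with it where the integrals can see it, so (phi, psi) solves the
    homogeneous open system and vanishes. *)
Lemma integral_system_unique f p f' p' d1 d2 :
  integral_system f p d1 d2 -> integral_system f' p' d1 d2 ->
  forall x, I x -> f x = f' x.
Proof.
move=> [nf np ef ep] [nf' np' ef' ep'].
pose F x := f x - f' x; pose P x := p x - p' x.
have nF : bounded_segs F := bounded_segsB nf nf'; have nP : bounded_segs P := bounded_segsB np np'.
have ipv := bounded_segsW rvs nP; have ifc := bounded_segsW rchi nF; have ifr := bounded_segsW rrho nF.
have cB mu h h' x : regular mu -> bounded_segs h -> bounded_segs h' -> I x ->
    cint mu (cseg x) (fun y => h y - h' y) = cint mu (cseg x) h - cint mu (cseg x) h'.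
  move=> rmu nh nh' Ix; apply: cintB => //.
  - by apply: (polar_onSI rmu); exact: cseg_sub.
  - exact: integrable_cseg (bounded_segsW rmu nh) Ix.
  - exact: integrable_cseg (bounded_segsW rmu nh') Ix.
have eF x : I x -> F x = sgn * cint vs (cseg x) P.
  by move=> Ix; rewrite cB // /F ef // ef' //; ring.
have eP x : I x -> P x = sgn * (cint chi (cseg x) F - z * cint rho (cseg x) F).
  by move=> Ix; rewrite !cB // /P ep // ep' //; ring.
pose phi x := sgn * cint vs (seg x) P.
pose psi x := sgn * (cint chi (seg x) F - z * cint rho (seg x) F).
have nphi : bounded_segs phi.
  by apply: bounded_segsM; [exact: bounded_segs_cst|exact: bounded_segs_cint_seg].
have npsi : bounded_segs psi.
  apply: bounded_segsM; first exact: bounded_segs_cst.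
  apply: bounded_segsB; first exact: bounded_segs_cint_seg.
  by apply: bounded_segsM; [exact: bounded_segs_cst|exact: bounded_segs_cint_seg].
have Fphi x : I x -> cm_var vs [set x] = 0%E -> F x = phi x.
  by move=> Ix v0; rewrite eF // cint_cseg_eq.
have Ppsi x : I x -> cm_var rho [set x] = 0%E -> cm_var chi [set x] = 0%E -> P x = psi x.
  by move=> Ix r0 c0; rewrite eP // !cint_cseg_eq.
have z0 : forall x, I x -> phi x = 0 /\ psi x = 0.
  apply: (volterra_unique0 (z := z) rrho rvs rchi nphi npsi) => x Ix;
    have DI := @seg_sub _ a b l x.
    by rewrite -(cint_ae rvs (mseg x) DI nP npsi (ae_vs Ppsi)).
  by rewrite -(cint_ae rchi (mseg x) DI nF nphi (ae_chi Fphi))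
    -(cint_ae rrho (mseg x) DI nF nphi (ae_rho Fphi)).
move=> x Ix; have [phi0 psi0] := z0 _ Ix.
apply/eqP; rewrite -subr_eq0; apply/eqP; rewrite -/(F x).
(* At an atom of [vs], F x could differ from phi x by the contribution of the atom. There [rho] and
   [chi] have no atom, so P x = psi x = 0 and this contribution vanishes. *)
have [v0|[r0 c0]] := atoms Ix; first by rewrite Fphi.
have P0 : P x = 0 by rewrite Ppsi.
by rewrite eF // (cint_cseg rvs ipv Ix) cint_atom0 // addr0.
Qed.

Lemma integral_system_lim f p d1 d2 : (exists x, I x) -> integral_system f p d1 d2 ->
  lim_end f d1 /\ lim_end p d2.
Proof.
move=> I0 [nf np ef ep]; split => e e0.
  have [al Ial hal] := cint_small rvs (bounded_segsW rvs np) I0 e0.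
  exists al; split => // x xal; have Ix := seg_sub xal.
  rewrite ef // addrC addKr (le_lt_trans (normc_le_abs1 _)) // abs1_sgn; exact: hal.
have i1 := bounded_segsW rchi nf.
have i2 := integrable_segsD (integrable_segsZ z (bounded_segsW rrho nf)) ig.
have e2 : 0 < e / 2 by lra.
have [al1 Ial1 hal1] := cint_small rchi i1 I0 e2.
have [al2 Ial2 hal2] := cint_small rrho i2 I0 e2.
have [al [Ial s1 s2]] : exists al, [/\ I al, seg al `<=` seg al1 & seg al `<=` seg al2].
  have [s|s|s] := seg_cmp l Ial1 Ial2; [exists al2|exists al1|exists al1]; split => //.
  - exact: seg_sub_seg.
  - exact: seg_sub_seg.
  - by rewrite s.
exists al; split => // x xal; have Ix := seg_sub xal.
rewrite ep // addrC addKr (le_lt_trans (normc_le_abs1 _)) // abs1_sgn.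
have pol : polar_on (cseg x) rho by apply: (polar_onSI rrho); exact: cseg_sub.
have ifx := integrable_cseg (bounded_segsW rrho nf) Ix.
rewrite -cintZ // -cintD //; last 2 first.
- exact: cintegrableZ.
- exact: integrable_cseg ig Ix.
apply: (le_lt_trans (abs1B _ _)).
have := hal1 _ (s1 _ xal); have := hal2 _ (s2 _ xal); lra.
Qed.

Lemma lim_end_unique f d d' : (exists x, I x) -> lim_end f d -> lim_end f d' -> d = d'.
Proof.
move=> [c Ic] h h'; apply/eqP; rewrite -subr_eq0; apply/eqP/abs1_eq0.
rewrite leNgt; apply/negP => e0.
(* Two error terms, each doubled on passing from [Normc.normc] to [abs1], add up to strictly less
   than [abs1 (d - d')]. *)
have e4 : 0 < abs1 (d - d') / 4 by lra.
have [al [Ial hal]] := h _ e4; have [al' [Ial' hal']] := h' _ e4.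
have [x [xa xa']] : exists x, seg al x /\ seg al' x.
  have [s|s|s] := seg_cmp l Ial Ial'.
  - have [x hx] := seg_prev l Ial'; exists x; split => //; exact: (seg_sub_seg s).
  - have [x hx] := seg_prev l Ial; exists x; split => //; exact: (seg_sub_seg s).
  - by rewrite -s; have [x hx] := seg_prev l Ial; exists x.
have := hal _ xa; have := hal' _ xa'.
have := abs1_le_normc (f x - d); have := abs1_le_normc (f x - d').
have : abs1 (d - d') <= abs1 (f x - d') + abs1 (f x - d).
  have -> : d - d' = (f x - d') - (f x - d) by ring.
  exact: abs1B.
lra.
Qed.

Definition conjf (h : R -> R[i]) x := (h x)^*%C.

Lemma cmeasurable_onJ D h : cmeasurable_on D h -> cmeasurable_on D (conjf h).
Proof.
move=> [h1 h2]; split.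
  apply: eq_measurable_fun h1 => x _; rewrite /conjf; by case: (h x).
have := measurableT_comp (@oppr_measurable R setT) h2.
by apply: eq_measurable_fun => x _; rewrite /conjf /=; case: (h x).
Qed.

Lemma abs1J x : abs1 x^*%C = abs1 x :> R.
Proof. by case: x => u v; rewrite /abs1 /= normrN. Qed.

Lemma bounded_segsJ h : bounded_segs h -> bounded_segs (conjf h).
Proof.
move=> [mh bh]; split; first exact: cmeasurable_onJ.
by move=> x Ix; have [C hC] := bh _ Ix; exists C => y xy; rewrite /conjf abs1J; exact: hC.
Qed.

(** For a real measure the density is real almost everywhere, so conjugating h conjugates the whole
    integrand almost everywhere. *)
Lemma cint_conj mu D h : regular mu -> real_cmeasure a b mu -> measurable D -> D `<=` I ->
  cintegrable (cm_var mu) D h -> cint mu D (conjf h) = (cint mu D h)^*%C.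
Proof.
move=> rmu re mD DI ih; have mh := cintegrable_measurable ih.
have pol := polar_onSI rmu DI.
have [i1 i2] := cintegrable_dens mD pol ih.
have mhd : cmeasurable_on D (fun x => h x * cm_dens mu x) by apply: cmeasurable_onM => //; case: pol.
have -> : cint mu D (conjf h) = cint_pos (cm_var mu) D (conjf (fun x => h x * cm_dens mu x)).
  apply: ae_eq_cint_pos => //.
  - by apply: cmeasurable_onM; [exact: cmeasurable_onJ|case: pol].
  - exact: cmeasurable_onJ.
  - apply: filterS re => x re Dx; rewrite /conjf.
    have := re (DI _ Dx); case: (cm_dens mu x) => u v /= ->.
    case: (h x) => u' v'; apply: complex_ext; rewrite ?ReM ?ImM /=; ring.
apply: complex_ext.
  by apply: eq_Rintegral => x _; rewrite /conjf; case: (h x * _).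
transitivity (-1 * Rintegral (cm_var mu) D (fun x => complex.Im (h x * cm_dens mu x))); last by rewrite mulN1r.
rewrite -RintegralZl //; apply: eq_Rintegral => x _.
by rewrite mulN1r /conjf; case: (h x * _).
Qed.

Lemma conjD (x y : R[i]) : (x + y)^*%C = x^*%C + y^*%C.
Proof. by apply: complex_ext; case: x => ? ?; case: y => ? ? //=; rewrite opprD. Qed.
Lemma conjN (x : R[i]) : (- x)^*%C = - x^*%C.
Proof. by case: x. Qed.
Lemma conjM (x y : R[i]) : (x * y)^*%C = x^*%C * y^*%C.
Proof. by apply: complex_ext; case: x => ? ?; case: y => ? ? //=; ring. Qed.
Lemma conj_real (x : R[i]) : complex.Im x = 0 -> x^*%C = x.
Proof. by case: x => u v /= ->; rewrite oppr0. Qed.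
Lemma conj_eq_real (x : R[i]) : x^*%C = x -> complex.Im x = 0.
Proof. by case: x => u v [] h /=; lra. Qed.

Lemma integral_system_conj f p d1 d2 :
  real_cmeasure a b rho -> real_cmeasure a b vs -> real_cmeasure a b chi ->
  complex.Im z = 0 -> {ae cm_var rho, forall x, I x -> complex.Im (g x) = 0} ->
  complex.Im d1 = 0 -> complex.Im d2 = 0 ->
  integral_system f p d1 d2 -> integral_system (conjf f) (conjf p) d1 d2.
Proof.
move=> rerho revs rechi zr gr d1r d2r [nf np ef ep].
have sr : sgn^*%C = sgn by apply: conj_real; rewrite /sgn; case: l => //=; rewrite oppr0.
split; [exact: bounded_segsJ|exact: bounded_segsJ| |] => x Ix; have DI := @cseg_sub _ a b l x.
  rewrite {1}/conjf ef // conjD conjM sr conj_real // cint_conj //.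
  exact: integrable_cseg (bounded_segsW rvs np) Ix.
have g1 : cint rho (cseg x) g = cint rho (cseg x) (conjf g).
  apply: ae_eq_cint => //.
  - exact: polar_onSI rrho _.
  - by apply: (cmeasurable_onS mI DI); case: ig.
  - by apply/cmeasurable_onJ/(cmeasurable_onS mI DI); case: ig.
  - by apply: filterS gr => t gr /DI /gr e; rewrite /conjf conj_real.
rewrite {1}/conjf ep // conjD conjM sr (conj_real d2r) conjD conjN conjD conjM (conj_real zr).
rewrite -!cint_conj //; last 3 first.
- exact: integrable_cseg ig Ix.
- exact: integrable_cseg (bounded_segsW rrho nf) Ix.
- exact: integrable_cseg (bounded_segsW rchi nf) Ix.
by rewrite -g1.
Qed.

Lemma integral_system_real f p d1 d2 :
  real_cmeasure a b rho -> real_cmeasure a b vs -> real_cmeasure a b chi ->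
  complex.Im z = 0 -> {ae cm_var rho, forall x, I x -> complex.Im (g x) = 0} ->
  complex.Im d1 = 0 -> complex.Im d2 = 0 ->
  integral_system f p d1 d2 -> forall x, I x -> complex.Im (f x) = 0.
Proof.
move=> rerho revs rechi zr gr d1r d2r sys x Ix; apply: conj_eq_real.
have sysJ := integral_system_conj rerho revs rechi zr gr d1r d2r sys.
exact: (integral_system_unique sysJ sys).
Qed.

End IntegralSystem.

(** * Integrals from an interior base point *)

Section IndefiniteIntegral.
Variables (R : realType) (a b : \bar R).
Notation I := (oitv a b).
Notation L1loc := (L1loc a b).

Let mI : measurable I. Proof. exact: measurable_oitv. Qed.

Let itv (u v : R) : set R := [set y | u <= y /\ y < v].

Let itvE u v : itv u v = `[u, v[%classic.
Proof.
by apply/seteqP; split => t /=; rewrite in_itv /=; [move=> [-> ->]|move=> /andP[]].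
Qed.

Let mitv u v : measurable (itv u v).
Proof. by rewrite itvE; exact: measurable_itv. Qed.

Let itv_sub u v : itv u v `<=` `[u, v]%classic.
Proof. by move=> t [ut /ltW tv]; rewrite /= in_itv /= ut. Qed.

Let itvI u v : I u -> I v -> itv u v `<=` I.
Proof. by move=> Iu Iv t /itv_sub; exact: itvcc_sub. Qed.

Let itv_integrable mu h u v : L1loc mu h -> I u -> I v -> cintegrable (cm_var mu) (itv u v) h.
Proof.
by move=> [_ ih] Iu Iv; apply: (cintegrableS _ _ (@itv_sub u v) (ih _ _ Iu Iv)).
Qed.

Let cint_chasles mu h u v w : polar_on I mu -> L1loc mu h -> I u -> I w ->
  u <= v -> v <= w -> cint mu (itv u w) h = cint mu (itv u v) h + cint mu (itv v w) h.
Proof.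
move=> pmu ih Iu Iw uv vw.
have e : itv u w = itv u v `|` itv v w.
  apply/seteqP; split => t.
    by move=> [ut tw]; have [tv|vt] := ltP t v; [left|right].
  move=> [[ut tv]|[vt tw]]; split => //; first exact: lt_le_trans vw.
  exact: le_trans vt.
rewrite {1}e cintU -?e //.
- by apply: (polar_onS mI _ pmu); exact: itvI.
- exact: itv_integrable.
- by apply/seteqP; split => // t [[_ tv] [vt _]]; move: (lt_le_trans tv vt); rewrite ltxx.
Qed.

Lemma cint_from_refl (mu : cmeasure R) c h : cint_from mu c c h = 0.
Proof. by rewrite /cint_from ltxx eqxx. Qed.

Lemma cint_fromB mu c h x y : polar_on I mu -> L1loc mu h -> I c -> I x -> I y -> y <= x ->
  cint_from mu c x h - cint_from mu c y h = cint mu [set t | y <= t /\ t < x] h.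
Proof.
move=> pmu ih Ic Ix Iy yx; rewrite -/(itv y x).
(* From a base point to the left of both [c] and [y], the three cases of [cint_from] become one
   formula, [base], and the claim is plain additivity. *)
have [al [Ial alc aly]] : exists al, [/\ I al, al <= c & al <= y].
  by have [cy|/ltW yc] := leP c y; [exists c|exists y].
have base t : I t -> al <= t -> cint_from mu c t h = cint mu (itv al t) h - cint mu (itv al c) h.
  move=> It alt; rewrite /cint_from; have [ct|tc|->] := ltgtP c t; last by rewrite subrr.
    by rewrite (@cint_chasles mu h al c t) // ?(ltW ct) // addrC addKr.
  by rewrite (@cint_chasles mu h al t c) // ?(ltW tc) //; ring.
rewrite !base //; last exact: le_trans yx.
by rewrite (@cint_chasles mu h al y x) //; ring.
Qed.

Lemma ae_eq_cint_from mu c h h' x : polar_on I mu -> I c -> I x ->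
  cmeasurable_on I h -> cmeasurable_on I h' ->
  {ae cm_var mu, forall x, I x -> h x = h' x} -> cint_from mu c x h = cint_from mu c x h'.
Proof.
move=> pmu Ic Ix mh mh' e.
have eq u v : I u -> I v -> cint mu (itv u v) h = cint mu (itv u v) h'.
  move=> Iu Iv; have s := itvI Iu Iv; apply: ae_eq_cint => //.
  - exact: polar_onS pmu.
  - exact: cmeasurable_onS mh.
  - exact: cmeasurable_onS mh'.
  - by apply: filterS e => t e /s /e.
by rewrite /cint_from -/(itv c x) -/(itv x c) !eq.
Qed.

(** On each side of [c] the domains of integration form a monotone family, increasing on the right
    and decreasing on the left; hence the splitting of the interval at [c]. *)
Lemma cmeasurable_cint_from mu c h : polar_on I mu -> L1loc mu h -> I c ->
  cmeasurable_on I (fun x => cint_from mu c x h).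
Proof.
move=> pmu ih Ic.
have iI := @oitv_is_interval _ a b.
pose J1 := [set x | I x /\ c < x]; pose J2 := [set x | I x /\ x <= c].
have iJ1 : is_interval J1.
  move=> x y [Ix cx] [Iy cy] t /andP[xt ty]; split; last exact: lt_le_trans xt.
  by apply: (iI _ _ Ix Iy); rewrite xt.
have iJ2 : is_interval J2.
  move=> x y [Ix cx] [Iy cy] t /andP[xt ty]; split; last exact: le_trans ty _.
  by apply: (iI _ _ Ix Iy); rewrite xt.
have U : I = J1 `|` J2.
  by apply/seteqP; split => [x Ix|x [] []//]; have [xc|cx] := leP x c; [right|left].
have c1 : cmeasurable_on J1 (fun x => cint_from mu c x h).
  apply: (@eq_cmeasurable_on _ _ (fun x => cint mu (itv c x) h)).
    by move=> x [_ cx]; rewrite /cint_from cx.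
  apply: cmeasurable_cint => //.
    by left => x y _ _ xy t [ct tx]; split => //; exact: lt_le_trans xy.
  move=> x [Ix _]; split; [exact: mitv|exact: polar_onS (itvI Ic Ix) pmu|exact: itv_integrable].
have c2 : cmeasurable_on J2 (fun x => cint_from mu c x h).
  apply: (@eq_cmeasurable_on _ _ (fun x => - cint mu (itv x c) h)).
    move=> x [_ xc]; rewrite /cint_from ltNge xc /=; case: eqP => // ->.
    have -> : itv c c = set0 by rewrite itvE set_itvco0.
    by rewrite cint_set0 oppr0.
  apply: cmeasurable_onN; apply: cmeasurable_cint => //.
    by right => x y _ _ xy t [ct tx]; split => //; exact: le_trans ct.
  move=> x [Ix _]; split; [exact: mitv|exact: polar_onS (itvI Ix Ic) pmu|exact: itv_integrable].
have m1 : measurable J1 by exact: is_interval_measurable.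
have m2 : measurable J2 by exact: is_interval_measurable.
by case: c1 c2 => h1 h2 [h3 h4]; rewrite U; split; apply/measurable_funU.
Qed.

(** Boundedness on compact subintervals only. Unlike [bounded_segs], this is immediate for functions
    in AC_loc. *)
Definition locally_bounded (h : R -> R[i]) := forall al be, I al -> I be ->
  exists C, forall x, `[al, be]%classic x -> abs1 (h x) <= C.

Lemma locally_bounded_cint_from mu c h : polar_on I mu -> L1loc mu h -> I c ->
  locally_bounded (fun x => cint_from mu c x h).
Proof.
move=> pmu ih Ic al be Ial Ibe.
have [al' [Ial' al1 al2]] : exists al', [/\ I al', al' <= c & al' <= al].
  by have [h1|/ltW h1] := leP c al; [exists c|exists al].
have [be' [Ibe' be1 be2]] : exists be', [/\ I be', c <= be' & be <= be'].
  by have [h1|/ltW h1] := leP c be; [exists be|exists c].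
have i := (proj2 ih) _ _ Ial' Ibe'; have mh := cintegrable_measurable i.
have mD : measurable (`[al', be']%classic : set R) by exact: measurable_itv.
have /(cintegrableP _ mD mh) ia := i.
pose C := 2 * fine (\int[cm_var mu]_(y in `[al', be']) (abs1 (h y))%:E).
have C0 : 0 <= C by rewrite mulr_ge0 // fine_ge0 // integral_ge0 // => t _; rewrite lee_fin abs1_ge0.
have bd u v : I u -> I v -> al' <= u -> v <= be' -> abs1 (cint mu (itv u v) h) <= C.
  move=> Iu Iv alu vbe.
  have s : itv u v `<=` `[al', be']%classic.
    move=> t [ut tv]; rewrite /= in_itv /= (le_trans alu ut) /=; exact: ltW (lt_le_trans tv vbe).
  rewrite -lee_fin; apply: (le_trans (abs1_cint_le (mitv u v) _ _)).
  - by apply: (polar_onS mI _ pmu); exact: itvI.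
  - exact: itv_integrable.
  rewrite EFinM; apply: lee_wpmul2l => //.
  rewrite fineK; last exact: (integrable_fin_num mD ia).
  apply: ge0_subset_integral => //; last by move=> t _; rewrite lee_fin abs1_ge0.
  by apply/measurable_EFinP; exact: measurable_abs1.
exists C => x xab; have Ix : I x := itvcc_sub Ial Ibe xab.
move: xab; rewrite /= in_itv /= => /andP[alx xbe]; rewrite /cint_from.
case: ifP => _; first by apply: bd => //; exact: le_trans be2.
case: ifP => _; first by rewrite abs1_0.
by rewrite abs1N; apply: bd => //; exact: le_trans al2 _.
Qed.

Lemma L1loc_bounded mu h : lf_cmeasure a b mu -> cmeasurable_on I h -> locally_bounded h ->
  L1loc mu h.
Proof.
move=> [_ [_ fmu]] mh bh; split => // al be Ial Ibe; have [C hC] := bh _ _ Ial Ibe.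
have mD : measurable (`[al, be]%classic : set R) by exact: measurable_itv.
apply: (cintegrable_bounded mD _ _ hC); first exact: fmu.
by apply: (cmeasurable_onS mI _ mh); exact: itvcc_sub.
Qed.

Lemma locally_boundedD h h' : locally_bounded h -> locally_bounded h' ->
  locally_bounded (fun x => h x + h' x).
Proof.
move=> b1 b2 al be Ial Ibe; have [C1 h1] := b1 _ _ Ial Ibe; have [C2 h2] := b2 _ _ Ial Ibe.
exists (C1 + C2) => x xab; apply: (le_trans (abs1D _ _)); apply: lerD; [exact: h1|exact: h2].
Qed.

Lemma locally_boundedN h : locally_bounded h -> locally_bounded (fun x => - h x).
Proof.
by move=> b1 al be Ial Ibe; have [C hC] := b1 _ _ Ial Ibe; exists C => x /hC; rewrite abs1N.
Qed.

Lemma locally_bounded_cst w : locally_bounded (fun=> w).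
Proof. by move=> al be _ _; exists (abs1 w). Qed.

Lemma eq_locally_bounded h h' : (forall x, I x -> h x = h' x) ->
  locally_bounded h -> locally_bounded h'.
Proof.
move=> e bh al be Ial Ibe; have [C hC] := bh _ _ Ial Ibe; exists C => x xab.
by rewrite -e; [exact: hC|exact: (itvcc_sub Ial Ibe)].
Qed.

Variable l : bool.
Notation seg := (seg a b l).
Notation cseg := (cseg a b l).
Notation sgn := (sgn R l).

Lemma cint_fromB_cseg mu c h x y : polar_on I mu -> L1loc mu h -> I c -> I x -> seg x y ->
  cint_from mu c x h - cint_from mu c y h = sgn * cint mu (cseg x `\` cseg y) h.
Proof.
move=> pmu ih Ic Ix xy; have Iy := seg_sub xy; move: xy => [_].
rewrite /sgn /cseg; case: l => /= xy.
  rewrite cint_fromB // ?(ltW xy) // mul1r; congr (cint mu _ h).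
  apply/seteqP; split => t /=.
    move=> [yt tx]; split; first by split => //; apply: (itvI Iy Ix).
    by move=> [_]; rewrite ltNge yt.
  by move=> [[It tx] nty]; split => //; rewrite leNgt; apply/negP => ty; apply: nty.
rewrite -[LHS]opprK opprB cint_fromB // ?(ltW xy) // mulN1r; congr (- cint mu _ h).
apply/seteqP; split => t /=.
  move=> [xt ty]; split; first by split => //; apply: (itvI Ix Iy).
  by move=> [_]; rewrite leNgt ty.
by move=> [[It tx] nty]; split => //; rewrite ltNge; apply/negP => ty; apply: nty.
Qed.

Lemma integrable_segs_L1loc mu h : integrable_segs a b l mu h -> L1loc mu h.
Proof.
move=> ih; split; first by case: ih.
move=> al be Ial Ibe; have [t It st] := itvcc_sub_seg l Ial Ibe.
by apply: (integrable_segsS ih It) => //; exact: measurable_itv.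
Qed.

(** Moves the base point from [c] to the endpoint; the change is a constant, which is absorbed in
    the value at the endpoint. *)
Lemma cint_fromE mu c h x : regular a b l mu -> integrable_segs a b l mu h -> I c -> I x ->
  cint_from mu c x h = sgn * (cint mu (cseg x) h - cint mu (cseg c) h).
Proof.
move=> rmu ih Ic Ix.
have lh := integrable_segs_L1loc ih; have pmu := proj1 rmu.
have split_cseg u v : I u -> seg u v ->
    cint mu (cseg u) h = cint mu (cseg v) h + cint mu (cseg u `\` cseg v) h.
  move=> Iu uv.
  have e : cseg u = cseg v `|` (cseg u `\` cseg v).
    rewrite setDUK //; apply: subset_trans (cseg_sub_seg uv) _; exact: seg_sub_cseg.
  rewrite {1}e cintU -?e //.
  - exact: measurable_cseg.
  - by apply: measurableD; exact: measurable_cseg.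
  - by apply: (polar_onS mI _ pmu); exact: cseg_sub.
  - exact: integrable_cseg.
  - exact: setDIK.
have [xc|cx|->] := seg_cmp l Ix Ic; last by rewrite cint_from_refl subrr mulr0.
  have := cint_fromB_cseg pmu lh Ic Ix xc; rewrite cint_from_refl subr0 => ->.
  by rewrite (split_cseg _ _ Ix xc) addrC addKr.
have := cint_fromB_cseg pmu lh Ic Ic cx; rewrite cint_from_refl sub0r => /eqP.
by rewrite eqr_oppLR => /eqP ->; rewrite (split_cseg _ _ Ic cx); ring.
Qed.

End IndefiniteIntegral.

(** * Equivalence with the integral system at a regular endpoint *)

Section Endpoint.
Variables (R : realType) (a b : \bar R) (l : bool).
Notation I := (oitv a b).
Notation seg := (seg a b l).
Notation cseg := (cseg a b l).
Notation regular := (regular a b l).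
Notation integrable_segs := (integrable_segs a b l).
Notation bounded_segs := (bounded_segs a b l).
Notation sgn := (sgn R l).
Notation L1loc := (L1loc a b).
Notation lim_end := (lim_end a b l).

Variables (rho vs chi : cmeasure R) (c : R) (z : R[i]) (g : R -> R[i]).
Hypotheses (lrho : lf_cmeasure a b rho) (lvs : lf_cmeasure a b vs) (lchi : lf_cmeasure a b chi).
Hypotheses (rrho : regular rho) (rvs : regular vs) (rchi : regular chi).
Hypothesis Ic : I c.
Hypothesis ig : integrable_segs rho g.
Hypothesis atoms : forall x, I x -> cm_var vs [set x] = 0%E \/
  (cm_var rho [set x] = 0%E /\ cm_var chi [set x] = 0%E).

Let mI : measurable I. Proof. exact: measurable_oitv. Qed.
Let mcseg x : measurable (cseg x). Proof. exact: measurable_cseg. Qed.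
Let mseg x : measurable (seg x). Proof. exact: measurable_seg. Qed.

Notation system := (integral_system a b l rho vs chi z g).

Let lg : L1loc rho g := integrable_segs_L1loc ig.

Let zfg f x := z * f x + g x.

(* Near the endpoint the mass of the three measures is so small that the
   supremum S of |f| + |p| over the points between x and c1 satisfies
   S <= K0 + S / 2, where K0 does not depend on x. *)
Let bounded_near_end f p :
  cmeasurable_on I f -> locally_bounded a b f ->
  cmeasurable_on I p -> locally_bounded a b p ->
  (forall x, I x -> f x = f c + cint_from vs c x p) ->
  (forall x, I x -> p x = p c + (cint_from chi c x f - cint_from rho c x (zfg f))) ->
  exists c1 C, I c1 /\ forall x, seg c1 x -> abs1 (f x) + abs1 (p x) <= C.
Proof.
move=> mf bf mp bp ef ep.
have l1p := L1loc_bounded lvs mp bp; have l1fc := L1loc_bounded lchi mf bf.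
have l1fr := L1loc_bounded lrho mf bf.
have l1D : L1loc rho (zfg f).
  split; first by apply: cmeasurable_onD; [apply: cmeasurable_onM => //; exact: cmeasurable_on_cst|case: ig].
  move=> al be Ial Ibe; have mab : measurable (`[al, be]%classic : set R) by exact: measurable_itv.
  apply: cintegrableD => //; last exact: (proj2 lg).
  by apply: cintegrableZ => //; exact: (proj2 l1fr).
pose k := 4 + 2 * abs1 z.
have k0 : 0 < k by exact: k_gt0.
pose tot := total_var rho vs chi.
have tfin := total_fin rrho rvs rchi.
(* Mass below 1 / (2 k) turns the factor k of [lin_bound] into the 1/2 in front of S. *)
have [c2 cc2 tc2] := seg_small (l := l) (lam := tot) Ic
  (ltac:(rewrite invr_gt0; lra) : 0 < (2 * k)^-1) (tfin _ Ic).
(* A second point [c1] strictly closer to the endpoint, so that [cseg c1] stays inside [seg c2] even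
   when it contains [c1]. *)
have Ic2 := seg_sub cc2; have [c1 c21] := seg_prev l Ic2; have Ic1 := seg_sub c21.
have igc2 := (proj2 ig) _ Ic2.
have /(cintegrableP _ (mseg c2) (cintegrable_measurable igc2)) iag := igc2.
pose G := fine (\int[cm_var rho]_(y in seg c2) (abs1 (g y))%:E).
pose u x := abs1 (f x) + abs1 (p x).
have u0 x : 0 <= u x by rewrite addr_ge0 ?abs1_ge0.
have G0 : 0 <= G by rewrite fine_ge0 // integral_ge0 // => t _; rewrite lee_fin abs1_ge0.
pose K0 := u c1 + 2 * G.
have K00 : 0 <= K0 by rewrite addr_ge0 // mulr_ge0.
exists c1, (2 * K0); split => // x c1x.
have Ix := seg_sub c1x.
(* The points from x to [c1], both included. They lie in a compact interval, so the supremum S is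
   finite before any bound up to the endpoint is known; the final bound 2 K0 no longer depends on
   x. *)
pose W := [set y | (seg c1 y \/ y = c1) /\ ~ seg x y].
have Wx : W x by split; [left|exact: seg_irr].
have WI y : W y -> I y by move=> [[/seg_sub|->]].
have [B hB] : exists B, forall y, W y -> u y <= B.
  have cpt y : W y -> `[Num.min x c1, Num.max x c1]%classic y.
    move=> Wy; have Iy := WI _ Wy; move: Wy => [c1y nxy].
    rewrite /= in_itv /= ge_min le_max.
    have xy : if l then x <= y else y <= x.
      have nb : ~ before l y x by move=> h; apply: nxy.
      by case: l nb => /= /negP; rewrite -leNgt.
    have yc : if l then y <= c1 else c1 <= y.
      move: c1y => [[_]|->]; last by case: ifP.
      by case: l => /= /ltW.
    by case: l xy yc => /= -> ->; rewrite ?orbT.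
  have Imin : I (Num.min x c1) by case: (leP x c1).
  have Imax : I (Num.max x c1) by case: (leP x c1).
  have [C1 h1] := bf _ _ Imin Imax; have [C2 h2] := bp _ _ Imin Imax.
  exists (C1 + C2) => y /cpt Wy; apply: lerD; [exact: h1|exact: h2].
pose A := [set u y | y in W].
have A0 : A !=set0 by exists (u x), x.
have hA : has_sup A by split => //; exists B => _ [y Wy <-]; exact: hB.
pose S := sup A.
have uS y : W y -> u y <= S by move=> Wy; apply: ub_le_sup; [case: hA|exists y].
have S0 : 0 <= S by apply: le_trans (uS _ Wx).
suff : S <= K0 + S / 2 by move=> h; have := uS _ Wx; rewrite /u; lra.
apply: ge_sup => // _ [y [c1y nxy] <-].
have Iy : I y by apply: WI.
case: c1y => [c1y|->]; last by rewrite /K0; lra.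
(* The set over which the equations are integrated between [y] and [c1]; it stays within [W], so S
   bounds the integrand on it. *)
pose D := cseg c1 `\` cseg y.
have mD : measurable D by exact: measurableD.
have Dc2 : D `<=` seg c2 by move=> t [ct _]; exact: (cseg_sub_seg c21).
have DI : D `<=` I by apply: subset_trans Dc2 _; exact: seg_sub.
have DW : D `<=` W.
  move=> t [ct nt]; split; first exact: csegW.
  move=> xt; apply: nt; apply: seg_sub_cseg; exact: (seg_total Ix Iy nxy).
have locint mu h : L1loc mu h -> cintegrable (cm_var mu) D h.
  move=> lh; have s : D `<=` `[Num.min y c1, Num.max y c1]%classic.
    move=> t [[It ct] nt]; rewrite /= in_itv /= ge_min le_max.
    have nt' : ~ (if l then t < y else y <= t) by move=> yt; apply: nt.
    case: l ct nt' => /= ct /negP; rewrite -?leNgt -?ltNge => yt.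
      by rewrite yt (ltW ct) orbT.
    by rewrite ct (ltW yt) orbT.
  have Imin : I (Num.min y c1) by case: (leP y c1).
  have Imax : I (Num.max y c1) by case: (leP y c1).
  by apply: (cintegrableS _ mD s ((proj2 lh) _ _ Imin Imax)); exact: measurable_itv.
have pol mu : regular mu -> polar_on D mu by move=> rmu; exact: (polar_onSI rmu).
have e1 : f y = f c1 - sgn * cint vs D p.
  rewrite -(cint_fromB_cseg (proj1 rvs) l1p Ic Ic1 c1y) (ef _ Iy) (ef _ Ic1); ring.
have e2 : p y = p c1 - sgn * (cint chi D f - z * cint rho D f - cint rho D g).
  have -> : sgn * (cint chi D f - z * cint rho D f - cint rho D g) =
     sgn * cint chi D f - sgn * cint rho D (zfg f).
    rewrite cintD // ?cintZ //; try exact: pol; try exact: locint; first by ring.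
    by apply: cintegrableZ => //; exact: locint.
  rewrite -(cint_fromB_cseg (proj1 rchi) l1fc Ic Ic1 c1y).
  rewrite -(cint_fromB_cseg (proj1 rrho) l1D Ic Ic1 c1y) (ep _ Iy) (ep _ Ic1); ring.
have b1 : abs1 (f y) <= abs1 (f c1) + abs1 (cint vs D p).
  by rewrite e1 (le_trans (abs1B _ _)) // abs1_sgn.
have b2 : abs1 (p y) <= abs1 (p c1) + (abs1 (cint chi D f - z * cint rho D f) + abs1 (cint rho D g)).
  rewrite e2 (le_trans (abs1B _ _)) // abs1_sgn lerD2l; exact: abs1B.
have b3 : abs1 (cint rho D g) <= 2 * G.
  rewrite -lee_fin; apply: (le_trans (abs1_cint_le mD (pol _ rrho) (locint _ _ lg))).
  rewrite EFinM; apply: lee_wpmul2l => //.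
  rewrite /G fineK; last exact: (integrable_fin_num (mseg c2) iag).
  apply: ge0_subset_integral => //; last by move=> t _; rewrite lee_fin abs1_ge0.
  by apply/measurable_EFinP; exact: measurable_abs1 (cintegrable_measurable igc2).
have b4 : abs1 (cint vs D p) + abs1 (cint chi D f - z * cint rho D f) <= S / 2.
  have mDf := cmeasurable_onS mI DI mf; have mDp := cmeasurable_onS mI DI mp.
  rewrite -lee_fin; apply: (le_trans (lin_bound z rrho rvs rchi mD DI
    (locint _ _ l1p) (locint _ _ l1fc) (locint _ _ l1fr))).
  rewrite -/k -/tot.
  apply: (@le_trans _ _ (k%:E * (S%:E * tot D))%E).
    apply: lee_wpmul2l; first by rewrite lee_fin ltW.
    rewrite -integral_cst //; apply: ge0_le_integral => //.
    - by move=> t _; rewrite lee_fin; exact: u0.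
    - apply/measurable_EFinP; apply: measurable_funD; exact: measurable_abs1.
    - by move=> t Dt; rewrite lee_fin; apply: uS; exact: DW.
  apply: (@le_trans _ _ (k%:E * (S%:E * (2 * k)^-1%:E))%E).
    apply: lee_wpmul2l; first by rewrite lee_fin ltW.
    apply: lee_wpmul2l; first by rewrite lee_fin.
    by apply: le_trans (ltW tc2); apply: le_measure; rewrite ?inE.
  rewrite -!EFinM lee_fin le_eqVlt; apply/orP; left; apply/eqP.
  by field; rewrite gt_eqF.
rewrite /u /K0; have : u c1 = abs1 (f c1) + abs1 (p c1) by [].
move: b1 b2 b3 b4; lra.
Qed.

Let bounded_segsI f c1 C : cmeasurable_on I f -> locally_bounded a b f -> I c1 ->
  (forall x, seg c1 x -> abs1 (f x) <= C) -> bounded_segs f.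
Proof.
move=> mf bf Ic1 hC; split => // x Ix.
have Imin : I (Num.min x c1) by case: (leP x c1).
have Imax : I (Num.max x c1) by case: (leP x c1).
have [B hB] := bf _ _ Imin Imax; exists (Num.max B C) => y xy; rewrite le_max.
have [c1y|nc1y] := pselect (seg c1 y); first by rewrite hC ?orbT.
rewrite hB //= in_itv /= ge_min le_max.
have [Iy yx] := xy; have nb : ~ before l y c1 by move=> h; apply: nc1y.
case: l yx nb => /= yx /negP; rewrite -leNgt => h.
  by rewrite h (ltW yx) orbT.
by rewrite h (ltW yx) orbT.
Qed.

Let cint_zfg f x : bounded_segs f -> I x ->
  cint rho (cseg x) (zfg f) = z * cint rho (cseg x) f + cint rho (cseg x) g.
Proof.
move=> nf Ix; have pol : polar_on (cseg x) rho by apply: (polar_onSI rrho); exact: cseg_sub.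
have i1 := integrable_cseg (bounded_segsW rrho nf) Ix.
rewrite (cintD (mcseg x) pol) ?cintZ //; first exact: cintegrableZ.
exact: integrable_cseg ig Ix.
Qed.

(** Once [f] and the quasi-derivative are bounded up to the endpoint, the integrals from [c] can be
    replaced by integrals from the endpoint. *)
Lemma solution_integral_system f F : solves_with a b rho vs chi c z g f F ->
  exists d1 d2, system f (qderiv chi c f F) d1 d2.
Proof.
move=> [hf [H [[lhf ef] [lH eF] ae1 ae2]]].
have [prho pvs pchi] : [/\ polar_on I rho, polar_on I vs & polar_on I chi].
  by split; [apply rrho|apply rvs|apply rchi].
have mf : cmeasurable_on I f.
  apply: (@eq_cmeasurable_on _ _ (fun x => f c + cint_from vs c x hf)); first by move=> x /ef.
  by apply: cmeasurable_onD; [exact: cmeasurable_on_cst|exact: cmeasurable_cint_from].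
have bf : locally_bounded a b f.
  apply: (@eq_locally_bounded _ _ _ (fun x => f c + cint_from vs c x hf)); first by move=> x /ef.
  by apply: locally_boundedD; [exact: locally_bounded_cst|exact: locally_bounded_cint_from].
have mF : cmeasurable_on I F.
  apply: (@eq_cmeasurable_on _ _ (fun x => F c + cint_from rho c x H)); first by move=> x /eF.
  by apply: cmeasurable_onD; [exact: cmeasurable_on_cst|exact: cmeasurable_cint_from].
have bF : locally_bounded a b F.
  apply: (@eq_locally_bounded _ _ _ (fun x => F c + cint_from rho c x H)); first by move=> x /eF.
  by apply: locally_boundedD; [exact: locally_bounded_cst|exact: locally_bounded_cint_from].
have l1fc := L1loc_bounded lchi mf bf.
set p := qderiv chi c f F.
have mp : cmeasurable_on I p by apply: cmeasurable_onB => //; exact: cmeasurable_cint_from.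
have bp : locally_bounded a b p.
  apply: locally_boundedD; first exact: locally_bounded_cint_from.
  exact: locally_boundedN.
have mD : cmeasurable_on I (zfg f).
  by apply: cmeasurable_onD; [apply: cmeasurable_onM => //; exact: cmeasurable_on_cst|case: ig].
(* The relation that defines F says that [hf] and the quasi-derivative agree [vs]-almost
   everywhere. *)
have ef' x : I x -> f x = f c + cint_from vs c x p.
  move=> Ix; rewrite ef //; congr (_ + _).
  apply: (ae_eq_cint_from pvs Ic Ix) => //; first by case: lhf.
  by apply: filterS ae1 => t h It; rewrite /p /qderiv h //; ring.
have ep x : I x -> p x = p c + (cint_from chi c x f - cint_from rho c x (zfg f)).
  move=> Ix; rewrite -(@ae_eq_cint_from _ a b rho c H) //;
    first by rewrite /p /qderiv cint_from_refl eF //; ring.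
    by case: lH.
  by apply: filterS ae2 => t h It; rewrite /zfg -h //; ring.
have [c1 [C [Ic1 hC]]] := bounded_near_end mf bf mp bp ef' ep.
have nf : bounded_segs f.
  by apply: (bounded_segsI (C := C) mf bf Ic1) => x /hC; apply: le_trans; rewrite lerDl abs1_ge0.
have np : bounded_segs p.
  by apply: (bounded_segsI (C := C) mp bp Ic1) => x /hC; apply: le_trans; rewrite lerDr abs1_ge0.
have iD : integrable_segs rho (zfg f).
  by apply: integrable_segsD => //; apply: integrable_segsZ; exact: bounded_segsW.
(* The values at the endpoint, found by solving the integral equations at x = c for the
   constants. *)
exists (f c - sgn * cint vs (cseg c) p),
  (p c - sgn * (cint chi (cseg c) f - cint rho (cseg c) (zfg f))).
split => // x Ix.
  by rewrite ef' // (cint_fromE rvs (bounded_segsW rvs np) Ic Ix); ring.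
rewrite ep // (cint_fromE rchi (bounded_segsW rchi nf) Ic Ix) (cint_fromE rrho iD Ic Ix).
by rewrite (cint_zfg nf Ix); ring.
Qed.

(** F is forced by the definition of the quasi-derivative. With the densities [p] and [zfg f], the
    two almost-everywhere conditions hold at every point. *)
Lemma integral_system_solution f p d1 d2 : system f p d1 d2 ->
  exists2 F, solves_with a b rho vs chi c z g f F & qderiv chi c f F = p.
Proof.
move=> [nf np ef ep]; exists (fun x => cint_from chi c x f - p x); last first.
  by apply/funext => x; rewrite /qderiv; ring.
have iD : integrable_segs rho (zfg f).
  by apply: integrable_segsD => //; apply: integrable_segsZ; exact: bounded_segsW.
exists p, (zfg f); split.
- split; first exact: integrable_segs_L1loc (bounded_segsW rvs np).
  by move=> x Ix; rewrite (cint_fromE rvs (bounded_segsW rvs np) Ic Ix) ef // [f c]ef //; ring.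
- split; first exact: integrable_segs_L1loc iD.
  move=> x Ix; rewrite cint_from_refl (cint_fromE rchi (bounded_segsW rchi nf) Ic Ix).
  rewrite (cint_fromE rrho iD Ic Ix) ep // [p c]ep //.
  by rewrite !cint_zfg //; ring.
- by apply: aeW => x Ix; ring.
- by apply: aeW => x Ix; rewrite /zfg; ring.
Qed.

Let I0 : exists x, I x := ex_intro _ c Ic.

Let solution_system f F d1 d2 : solves_with a b rho vs chi c z g f F ->
  lim_end f d1 -> lim_end (qderiv chi c f F) d2 -> system f (qderiv chi c f F) d1 d2.
Proof.
move=> sol l1 l2; have [e1 [e2 sys]] := solution_integral_system sol.
have [l1' l2'] := integral_system_lim rrho rvs rchi ig I0 sys.
by rewrite (lim_end_unique I0 l1 l1') (lim_end_unique I0 l2 l2').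
Qed.

Lemma initial_value_problem :
  [/\ (forall f F, solves_with a b rho vs chi c z g f F ->
          (exists d1, lim_end f d1) /\ (exists d2, lim_end (qderiv chi c f F) d2)),
       (forall d1 d2,
          (exists f F, solves_with a b rho vs chi c z g f F /\
             lim_end f d1 /\ lim_end (qderiv chi c f F) d2) /\
          (forall f1 F1 f2 F2,
             solves_with a b rho vs chi c z g f1 F1 ->
             lim_end f1 d1 -> lim_end (qderiv chi c f1 F1) d2 ->
             solves_with a b rho vs chi c z g f2 F2 ->
             lim_end f2 d1 -> lim_end (qderiv chi c f2 F2) d2 ->
             forall x, oitv a b x -> f1 x = f2 x)) &
       (real_cmeasure a b rho -> real_cmeasure a b vs ->
        real_cmeasure a b chi ->
        complex.Im z = 0 ->
        {ae cm_var rho, forall x, oitv a b x -> complex.Im (g x) = 0} ->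
        forall d1 d2, complex.Im d1 = 0 -> complex.Im d2 = 0 ->
        forall f F, solves_with a b rho vs chi c z g f F ->
          lim_end f d1 -> lim_end (qderiv chi c f F) d2 ->
          forall x, oitv a b x -> complex.Im (f x) = 0)].
Proof.
split.
- move=> f F sol; have [d1 [d2 sys]] := solution_integral_system sol.
  by have [l1 l2] := integral_system_lim rrho rvs rchi ig I0 sys; split; [exists d1|exists d2].
- move=> d1 d2; split.
    have [f [p sys]] := integral_system_exists z rrho rvs rchi ig atoms d1 d2.
    have [F sol qF] := integral_system_solution sys; exists f, F; rewrite qF.
    by split => //; exact: integral_system_lim sys.
  move=> f1 F1 f2 F2 s1 l1 l1' s2 l2 l2'.
  exact: (integral_system_unique rrho rvs rchi atoms (solution_system s1 l1 l1')
    (solution_system s2 l2 l2')).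
- move=> rerho revs rechi zr gr d1 d2 r1 r2 f F sol l1 l2.
  exact: (integral_system_real rrho rvs rchi ig atoms rerho revs rechi zr gr r1 r2
    (solution_system sol l1 l2)).
Qed.

End Endpoint.

(** * Translation of the hypotheses and of the limits *)

Section Hypotheses.
Variables (R : realType) (a b : \bar R).
Notation I := (oitv a b).

(** The complex mass of {x} is the density at x times the variation of {x}, and the density has
    modulus 1. *)
Lemma cmeas_set1_eq0 mu x : lf_cmeasure a b mu -> I x -> cmeas mu [set x] = 0 ->
  cm_var mu [set x] = 0%E.
Proof.
move=> [_ [p1 fmu]] Ix; rewrite /cmeas /cint /cint_pos.
have f1 : (cm_var mu [set x] < +oo)%E by have := fmu x x Ix Ix; rewrite set_itv1.
have e w : Rintegral (cm_var mu) [set x] (fun=> w) = w * fine (cm_var mu [set x]).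
  by apply: Rintegral_cst; exact: measurable_set1.
rewrite (@eq_Rintegral _ _ _ _ _ (fun=> complex.Re (cm_dens mu x))); last first.
  by move=> t; rewrite inE /= => tx; rewrite tx mul1r.
rewrite [X in Complex _ X](@eq_Rintegral _ _ _ _ _ (fun=> complex.Im (cm_dens mu x))); last first.
  by move=> t; rewrite inE /= => tx; rewrite tx mul1r.
rewrite !e => -[/eqP + /eqP]; rewrite !mulf_eq0.
have ff : fine (cm_var mu [set x]) == 0 -> cm_var mu [set x] = 0%E.
  by move=> /eqP h; rewrite -[LHS]fineK ?h // ge0_fin_numE.
move=> /orP[re|/ff//] /orP[im|/ff//].
have := p1 _ Ix; have -> : cm_dens mu x = 0.
  by apply: complex_ext; apply/eqP.
by rewrite Normc.normc0 => /eqP; rewrite eq_sym oner_eq0.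
Qed.

(** Finiteness near the endpoint for one point gives it for all: the segment of x exceeds that of
    [c0] at most by a compact interval, which has finite mass. *)
Lemma regular_at l mu c0 : lf_cmeasure a b mu -> I c0 ->
  (cm_var mu (seg a b l c0) < +oo)%E -> regular a b l mu.
Proof.
move=> [md [p1 fmu]] Ic0 fc0; split; first by split.
move=> x Ix.
have Imin : I (Num.min x c0) by case: (leP x c0).
have Imax : I (Num.max x c0) by case: (leP x c0).
apply: (@le_lt_trans _ _ (cm_var mu (seg a b l c0 `|` `[Num.min x c0, Num.max x c0]))).
  apply: le_measure; rewrite ?inE; first exact: measurable_seg.
    by apply: measurableU; [exact: measurable_seg|exact: measurable_itv].
  move=> y [Iy yx]; have [cy|ncy] := pselect (seg a b l c0 y); [by left|right].
  rewrite /= in_itv /= ge_min le_max.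
  have nb : ~ before l y c0 by move=> h; apply: ncy.
  by case: l yx nb {fc0 ncy} => /= yx /negP; rewrite -leNgt => h; rewrite h (ltW yx) orbT.
apply: (le_lt_trans (measureU2 _ _ _)); [exact: measurable_seg|exact: measurable_itv|].
by apply: lte_add_pinfty => //; exact: fmu.
Qed.

Lemma lim_left_endE f d : lim_at_left_end a b f d <-> lim_end a b true f d.
Proof.
split=> h e e0; have [al [Ial hal]] := h e e0; exists al; split => // x.
  by move=> [[ax _] xal]; exact: hal.
move=> ax xal; apply: hal; split => //; split => //.
by apply: lt_trans (proj2 Ial); rewrite lte_fin.
Qed.

Lemma lim_right_endE f d : lim_at_right_end a b f d <-> lim_end a b false f d.
Proof.
split=> h e e0; have [be [Ibe hbe]] := h e e0; exists be; split => // x.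
  by move=> [[_ xb] bex]; exact: hbe.
move=> bex xb; apply: hbe; split => //; split => //.
by apply: lt_trans (proj1 Ibe) _; rewrite lte_fin.
Qed.

Lemma seg_leftE c : I c -> seg a b true c = [set x | (a < x%:E)%E /\ x < c].
Proof.
move=> [ac cb]; apply/seteqP; split => x; first by move=> [[]].
by move=> [ax xc]; split => //; split => //; apply: lt_trans cb; rewrite lte_fin.
Qed.

Lemma seg_rightE c : I c -> seg a b false c = [set x | c < x /\ (x%:E < b)%E].
Proof.
move=> [ac cb]; apply/seteqP; split => x; first by move=> [[]].
by move=> [cx xb]; split => //; split => //; apply: lt_trans ac _; rewrite lte_fin.
Qed.

End Hypotheses.

Theorem theorem3p5 (R : realType) (a b : \bar R) (rho vs chi : cmeasure R)
    (c : R) (z : R[i]) (g : R -> R[i]) :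
  (a < b)%E ->
  lf_cmeasure a b rho -> lf_cmeasure a b vs -> lf_cmeasure a b chi ->
  csupp a b vs = oitv a b ->
  (forall x, oitv a b x ->
     cmeas vs [set x] * cmeas rho [set x] = 0 /\
     cmeas vs [set x] * cmeas chi [set x] = 0) ->
  oitv a b c ->
  L1loc a b rho g ->
  (* ---------------- endpoint a ---------------- *)
  ((exists c0, oitv a b c0 /\
      let J := [set x | (a < x%:E)%E /\ x <= c0] in
      [/\ (cm_var rho J < +oo)%E, (cm_var vs J < +oo)%E &
          (cm_var chi J < +oo)%E]) ->
   (forall c1, oitv a b c1 ->
      cintegrable (cm_var rho) [set x | (a < x%:E)%E /\ x < c1] g) ->
   [/\ (forall f F, solves_with a b rho vs chi c z g f F ->
          (exists d1, lim_at_left_end a b f d1) /\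
          (exists d2, lim_at_left_end a b (qderiv chi c f F) d2)),
       (forall d1 d2,
          (exists f F, solves_with a b rho vs chi c z g f F /\
             lim_at_left_end a b f d1 /\
             lim_at_left_end a b (qderiv chi c f F) d2) /\
          (forall f1 F1 f2 F2,
             solves_with a b rho vs chi c z g f1 F1 ->
             lim_at_left_end a b f1 d1 ->
             lim_at_left_end a b (qderiv chi c f1 F1) d2 ->
             solves_with a b rho vs chi c z g f2 F2 ->
             lim_at_left_end a b f2 d1 ->
             lim_at_left_end a b (qderiv chi c f2 F2) d2 ->
             forall x, oitv a b x -> f1 x = f2 x)) &
       (real_cmeasure a b rho -> real_cmeasure a b vs ->
        real_cmeasure a b chi ->
        complex.Im z = 0 ->
        {ae cm_var rho, forall x, oitv a b x -> complex.Im (g x) = 0} ->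
        forall d1 d2, complex.Im d1 = 0 -> complex.Im d2 = 0 ->
        forall f F, solves_with a b rho vs chi c z g f F ->
          lim_at_left_end a b f d1 ->
          lim_at_left_end a b (qderiv chi c f F) d2 ->
          forall x, oitv a b x -> complex.Im (f x) = 0)]) /\
  (* ---------------- endpoint b ---------------- *)
  ((exists c0, oitv a b c0 /\
      let J := [set x | c0 <= x /\ (x%:E < b)%E] in
      [/\ (cm_var rho J < +oo)%E, (cm_var vs J < +oo)%E &
          (cm_var chi J < +oo)%E]) ->
   (forall c1, oitv a b c1 ->
      cintegrable (cm_var rho) [set x | c1 < x /\ (x%:E < b)%E] g) ->
   [/\ (forall f F, solves_with a b rho vs chi c z g f F ->
          (exists d1, lim_at_right_end a b f d1) /\
          (exists d2, lim_at_right_end a b (qderiv chi c f F) d2)),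
       (forall d1 d2,
          (exists f F, solves_with a b rho vs chi c z g f F /\
             lim_at_right_end a b f d1 /\
             lim_at_right_end a b (qderiv chi c f F) d2) /\
          (forall f1 F1 f2 F2,
             solves_with a b rho vs chi c z g f1 F1 ->
             lim_at_right_end a b f1 d1 ->
             lim_at_right_end a b (qderiv chi c f1 F1) d2 ->
             solves_with a b rho vs chi c z g f2 F2 ->
             lim_at_right_end a b f2 d1 ->
             lim_at_right_end a b (qderiv chi c f2 F2) d2 ->
             forall x, oitv a b x -> f1 x = f2 x)) &
       (real_cmeasure a b rho -> real_cmeasure a b vs ->
        real_cmeasure a b chi ->
        complex.Im z = 0 ->
        {ae cm_var rho, forall x, oitv a b x -> complex.Im (g x) = 0} ->
        forall d1 d2, complex.Im d1 = 0 -> complex.Im d2 = 0 ->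
        forall f F, solves_with a b rho vs chi c z g f F ->
          lim_at_right_end a b f d1 ->
          lim_at_right_end a b (qderiv chi c f F) d2 ->
          forall x, oitv a b x -> complex.Im (f x) = 0)]).
Proof.
move=> ab lrho lvs lchi _ at0 Ic lg.
(* The vanishing products become an alternative between total variations: either [vs] has no atom at
   x, or both [rho] and [chi] have none. *)
have atoms x : oitv a b x -> cm_var vs [set x] = 0%E \/
    (cm_var rho [set x] = 0%E /\ cm_var chi [set x] = 0%E).
  move=> Ix; have [/eqP + /eqP] := at0 x Ix; rewrite !mulf_eq0.
  move=> /orP[/eqP/(cmeas_set1_eq0 lvs Ix)|/eqP/(cmeas_set1_eq0 lrho Ix)]; first by left.
  move=> r0 /orP[/eqP/(cmeas_set1_eq0 lvs Ix)|/eqP/(cmeas_set1_eq0 lchi Ix)]; first by left.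
  by right.
split.
  move=> [c0 [Ic0 [frho fvs fchi]]] ig.
  have reg mu : lf_cmeasure a b mu ->
      (cm_var mu [set x | (a < x%:E)%E /\ (x <= c0)%R]%classic < +oo)%E -> regular a b true mu.
    move=> lmu fmu; apply: (regular_at lmu Ic0); apply: le_lt_trans fmu.
    apply: le_measure; rewrite ?inE; first exact: measurable_seg.
      apply: is_interval_measurable => x y [ax _] [_ yc] t /andP[xt ty].
      by split; [apply: lt_le_trans ax _; rewrite lee_fin|exact: le_trans yc].
    by move=> x [[ax _] /ltW].
  have ig' : integrable_segs a b true rho g.
    by split; [case: lg|move=> x Ix; rewrite (seg_leftE Ix); exact: ig].
  have [lims sol real] := initial_value_problem z lrho lvs lchi (reg _ lrho frho)
    (reg _ lvs fvs) (reg _ lchi fchi) Ic ig' atoms.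
  split.
  - move=> f F /lims[[d1 h1] [d2 h2]].
    by split; [exists d1|exists d2]; apply/lim_left_endE.
  - move=> d1 d2; have [[f [F [s [h1 h2]]]] uniq] := sol d1 d2; split.
      by exists f, F; split => //; split; apply/lim_left_endE.
    move=> f1 F1 f2 F2 s1 /lim_left_endE h11 /lim_left_endE h12 s2 /lim_left_endE h21
      /lim_left_endE h22; exact: (uniq f1 F1 f2 F2).
  - move=> rr rv rc zr gr d1 d2 r1 r2 f F s /lim_left_endE h1 /lim_left_endE h2.
    exact: (real rr rv rc zr gr d1 d2 r1 r2 f F).
move=> [c0 [Ic0 [frho fvs fchi]]] ig.
have reg mu : lf_cmeasure a b mu ->
    (cm_var mu [set x | (c0 <= x)%R /\ (x%:E < b)%E]%classic < +oo)%E -> regular a b false mu.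
  move=> lmu fmu; apply: (regular_at lmu Ic0); apply: le_lt_trans fmu.
  apply: le_measure; rewrite ?inE; first exact: measurable_seg.
    apply: is_interval_measurable => x y [cx _] [_ yb] t /andP[xt ty].
    by split; [exact: le_trans xt|apply: le_lt_trans yb; rewrite lee_fin].
  by move=> x [[_ xb] /ltW].
have ig' : integrable_segs a b false rho g.
  by split; [case: lg|move=> x Ix; rewrite (seg_rightE Ix); exact: ig].
have [lims sol real] := initial_value_problem z lrho lvs lchi (reg _ lrho frho)
  (reg _ lvs fvs) (reg _ lchi fchi) Ic ig' atoms.
split.
- move=> f F /lims[[d1 h1] [d2 h2]].
  by split; [exists d1|exists d2]; apply/lim_right_endE.
- move=> d1 d2; have [[f [F [s [h1 h2]]]] uniq] := sol d1 d2; split.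
    by exists f, F; split => //; split; apply/lim_right_endE.
  move=> f1 F1 f2 F2 s1 /lim_right_endE h11 /lim_right_endE h12 s2 /lim_right_endE h21
    /lim_right_endE h22; exact: (uniq f1 F1 f2 F2).
- move=> rr rv rc zr gr d1 d2 r1 r2 f F s /lim_right_endE h1 /lim_right_endE h2.
  exact: (real rr rv rc zr gr d1 d2 r1 r2 f F).
Qed.
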